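(* Let $k\ge 2$ and let $M^{k-1}$ be a connected, compact, embedded minimal hypersurface of $S^k$. Then for every $\nu\in S^k$, the set $$M_+(\nu):=M\cap H_+(\nu),\qquad H_+(\nu)=\{p\in S^k:\langle p,\nu\rangle>0\},$$ is connected. In other words, any $(k-1)$-dimensional equator $S^{k-1}[\nu]=\{p\in S^k:\langle p,\nu\rangle=0\}$ divides $M$ into two connected pieces, $M\cap H_+(\nu)$ and $M\cap H_-(\nu)$, where $H_-(\nu)=\{p\in S^k:\langle p,\nu\rangle<0\}$.
   Context: $S^k\subset\mathbb{R}^{k+1}$ is the unit sphere with its standard round metric, and $\langle\cdot,\cdot\rangle$ is the Euclidean inner product of $\mathbb{R}^{k+1}$. All manifolds are complete and without boundary. With $N$ a (local) unit normal field along a hypersurface $M^{k-1}\subset S^k$ and $\{e_i\}_{i=1}^{k-1}$ a local orthonormal frame tangent to $M$, the mean curvature is $H=\frac{1}{k-1}\sum_{i=1}^{k-1}\langle D_{e_i}N,e_i\rangle$; $M$ is minimal if $H$ vanishes identically. The empty set is regarded as connected (it occurs as $M_+(\nu)$ when $M=S^{k-1}[\nu]$). *)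

(* Defs.v *)
From HB Require Import structures.
From mathcomp Require Import all_boot all_order all_algebra.
From mathcomp Require Import all_classical all_reals all_analysis.

Set Implicit Arguments.
Unset Strict Implicit.
Unset Printing Implicit Defensive.

Import Order.TTheory GRing.Theory Num.Theory.
Import numFieldNormedType.Exports.

Local Open Scope classical_set_scope.
Local Open Scope ring_scope.

(* Euclidean inner product.  The library norm of 'rV[R]_n is the sup norm, so
   it is used only through the topology and the notion of derivative, which do
   not depend on the choice of a norm. *)
Definition dot (R : realType) (n : nat) (u v : 'rV[R]_n) : R :=
  \sum_(i < n) u ord0 i * v ord0 i.

Fixpoint C_on (R : realType) (V W : normedModType R) (r : nat) (U : set V)
    (f : V -> W) : Prop :=
  match r with
  | 0 => forall x, U x -> {for x, continuous f}
  | r'.+1 => (forall x, U x -> differentiable f x) /\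
             (forall v : V, C_on r' U ('D_v f))
  end.

(* Meaningful for open U. *)
Definition smooth_on (R : realType) (V W : normedModType R) (U : set V)
    (f : V -> W) : Prop :=
  forall r, C_on r U f.

(* phi is a smooth immersion of the open set V of R^m, and a homeomorphism of V
   onto the relatively open subset M `&` U of M, with inverse psi. *)
Definition local_parametrization (R : realType) (m n : nat)
    (M : set 'rV[R]_n) (V : set 'rV[R]_m) (phi : 'rV[R]_m -> 'rV[R]_n)
    (U : set 'rV[R]_n) : Prop :=
  [/\ open V /\ open U,
      smooth_on V phi,
      forall x, V x -> injective ('d phi x),
      phi @` V = M `&` U &
      exists psi : 'rV[R]_n -> 'rV[R]_m,
        (forall x, V x -> psi (phi x) = x) /\
        {within M `&` U, continuous psi}].

Definition embedded_submanifold (R : realType) (m n : nat)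
    (M : set 'rV[R]_n) : Prop :=
  forall p, M p ->
    exists (V : set 'rV[R]_m) (phi : 'rV[R]_m -> 'rV[R]_n) (U : set 'rV[R]_n),
      U p /\ local_parametrization M V phi U.

(* T_p M as the set of velocities at p of smooth curves in M. *)
Definition tangent (R : realType) (n : nat) (M : set 'rV[R]_n) (p : 'rV[R]_n) :
    set 'rV[R]_n :=
  [set v | exists (e : R) (gamma : R -> 'rV[R]_n),
     [/\ 0 < e,
         smooth_on `]- e, e[%classic gamma,
         forall t, `]- e, e[%classic t -> M (gamma t),
         gamma 0 = p &
         derive1 gamma 0 = v]].

Definition sphere (R : realType) (k : nat) : set 'rV[R]_k.+1 :=
  [set p | dot p p = 1].

Definition embedded_hypersurface (R : realType) (k : nat)
    (M : set 'rV[R]_k.+1) : Prop :=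
  M `<=` @sphere R k /\ @embedded_submanifold R k.-1 k.+1 M.

(* A unit normal field of M in the sphere, on the open piece M `&` U.  It is
   given as a smooth map on the open set U of the ambient space; its
   derivatives along tangent vectors of M depend only on its values on M. *)
Definition unit_normal_on (R : realType) (k : nat) (M U : set 'rV[R]_k.+1)
    (N : 'rV[R]_k.+1 -> 'rV[R]_k.+1) : Prop :=
  [/\ open U,
      smooth_on U N &
      forall q, M q -> U q ->
        [/\ dot (N q) (N q) = 1,
            dot (N q) q = 0 &
            forall v, tangent M q v -> dot (N q) v = 0]].

Definition orthonormal_frame (R : realType) (k : nat) (M : set 'rV[R]_k.+1)
    (p : 'rV[R]_k.+1) (e : 'I_k.-1 -> 'rV[R]_k.+1) : Prop :=
  (forall i, tangent M p (e i)) /\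
  (forall i j, dot (e i) (e j) = (i == j)%:R).

(* D is the flat derivative of the ambient space: its covariant counterpart on
   the sphere differs from it by a multiple of p, which is orthogonal to e i. *)
Definition mean_curvature (R : realType) (k : nat)
    (N : 'rV[R]_k.+1 -> 'rV[R]_k.+1) (e : 'I_k.-1 -> 'rV[R]_k.+1)
    (p : 'rV[R]_k.+1) : R :=
  (k.-1)%:R^-1 * \sum_(i < k.-1) dot ('D_(e i) N p) (e i).

Definition minimal (R : realType) (k : nat) (M : set 'rV[R]_k.+1) : Prop :=
  forall (p : 'rV[R]_k.+1) (U : set 'rV[R]_k.+1)
    (N : 'rV[R]_k.+1 -> 'rV[R]_k.+1) (e : 'I_k.-1 -> 'rV[R]_k.+1),
    M p -> U p -> unit_normal_on M U N -> orthonormal_frame M p e ->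
    mean_curvature N e p = 0.

Definition open_hemisphere_pos (R : realType) (k : nat) (nu : 'rV[R]_k.+1) :
    set 'rV[R]_k.+1 :=
  [set p | sphere p /\ 0 < dot p nu].

Definition open_hemisphere_neg (R : realType) (k : nat) (nu : 'rV[R]_k.+1) :
    set 'rV[R]_k.+1 :=
  [set p | sphere p /\ dot p nu < 0].

Definition equator (R : realType) (k : nat) (nu : 'rV[R]_k.+1) :
    set 'rV[R]_k.+1 :=
  [set p | sphere p /\ dot p nu = 0].

(* Main.v *)
(* Write u for the linear function <., nu> and suppose that M_+(nu) is the union of two
   nonempty separated sets A and B.  Put
     Z(x, y) = (1 - <x, y>) / (u(x) u(y)),   x in A, y in B
   (a function of the hyperbolic distance when the open hemisphere is seen as the conformal
   model g / u^2 of hyperbolic space).  Z tends to infinity when u(x) or u(y) tends to 0: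
   this could only fail near a point p of M on the equator with x and y both close to p.  If
   the differential of u on M does not vanish at p, then M_+(nu) is connected near p, so x
   and y cannot both be close to p; if it vanishes, a path in a chart from x to y leaves
   M_+(nu), so u(x) and u(y) are bounded by a small multiple of |x - y|.  Hence Z has an
   interior minimum c0, and for c slightly below c0 the bilinear form <x, P y>, where
   P = 1 + c nu nu^T, has on a compact part of A x B an interior maximum s with 0 < s < 1.

   At such a maximum the tangent spaces are T_x = {x, P y}^perp and T_y = {y, P x}^perp.
   Choose orthonormal frames e_i of T_x and f_i of T_y that agree except in one direction,
   where they lie in the space spanned by x, y, nu and are given by cross products.  Moving
   x along e_i and y along f_i and summing the second derivatives, the second fundamental
   forms drop out because M is minimal, and one gets
     sum_i <e_i, P f_i> <= s (k - 1).
   But the k - 2 common directions contribute 1 each and the last one more than s. *)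

Require Import Defs.
From HB Require Import structures.
From mathcomp Require Import all_boot all_order all_algebra.
From mathcomp Require Import all_classical all_reals all_analysis.
From mathcomp Require Import ring lra.

Set Implicit Arguments.
Unset Strict Implicit.
Unset Printing Implicit Defensive.

Import Order.TTheory GRing.Theory Num.Theory.
Import numFieldNormedType.Exports.

Local Open Scope classical_set_scope.
Local Open Scope ring_scope.

(** * Maps of class C^r *)

Lemma differentiable_estimate (R : realType) (V W : normedModType R) (f : V -> W)
    (x : V) (e : R) :
  differentiable f x -> 0 < e ->
  \forall h \near 0, `|f (h + x) - f x - 'd f x h| <= e * `|h|.
Proof.
move=> /diff_locallyP[_ /eqaddoP fE] e0; near=> h.
have : `|(f \o shift x - (cst (f x) + 'd f x)) h| <= e * `|h| by near: h; exact: fE.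
by rewrite /= opprD addrA.
Unshelve. all: by end_near. Qed.

Lemma estimate_differentiable (R : realType) (V W : normedModType R) (f : V -> W)
    (x : V) (L : {linear V -> W}) : continuous L ->
  (forall e, 0 < e -> \forall h \near (0 : V), `|f (h + x) - f x - L h| <= e * `|h|) ->
  differentiable f x /\ 'd f x = L :> (V -> W).
Proof.
move=> cL H.
have fE : f \o shift x = cst (f x) + L +o_ (0 : V) id.
  apply/eqaddoP => e e0; near=> h.
  rewrite [X in `|X| <= _](_ : _ = f (h + x) - f x - L h); first by near: h; exact: H.
  by rewrite /= /GRing.add/= /GRing.opp/= opprD addrA.
have dE := diff_unique cL fE; split => //.
by apply/diff_locallyP; rewrite dE.
Unshelve. all: by end_near. Qed.

Lemma near_eq_differentiable (R : realType) (V W : normedModType R) (f g : V -> W)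
    (x : V) : {near x, f =1 g} -> differentiable f x -> differentiable g x.
Proof.
move=> fg df.
apply: (proj1 (@estimate_differentiable R V W g x ('d f x) _ _)).
- exact: diff_continuous.
- move=> e e0.
  have fg0 : \forall h \near (0:V), f (h + x) = g (h + x).
    move: fg; rewrite {1}(near_shift 0 x) /=.
    by apply: filterS => h /=; rewrite subr0.
  near=> h; rewrite -(near fg0 h)// -(nbhs_singleton fg).
  by near: h; exact: differentiable_estimate.
Unshelve. all: by end_near. Qed.

Lemma C_onS (R : realType) (V W : normedModType R) (r : nat) (U : set V)
    (f : V -> W) : C_on r.+1 U f <->
  (forall x, U x -> differentiable f x) /\ (forall v, C_on r U ('D_v f)).
Proof. by []. Qed.

(** Derivatives at a point of the open set [U] only see the germ of the map, so equality on [U]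
    passes to every directional derivative that [C_on] inspects. *)
Lemma C_on_ext (R : realType) (V W : normedModType R) (r : nat) (U : set V)
    (f g : V -> W) : open U -> (forall x, U x -> f x = g x) ->
  C_on r U f -> C_on r U g.
Proof.
move=> oU; elim: r f g => [|r IH] f g fg /=.
- move=> cf x Ux; have fgx : {near x, f =1 g} by apply: filterS fg _; exact: open_nbhs_nbhs.
  move: (cf x Ux); rewrite /prop_for /continuous_at (fg x Ux).
  by apply: cvg_trans; apply: near_eq_cvg; apply: filterS fgx => y ->.
- move=> [df Df]; split.
    move=> x Ux; apply: near_eq_differentiable (df x Ux).
    by apply: filterS fg _; exact: open_nbhs_nbhs.
  move=> v; apply: IH (Df v) => x Ux.
  by apply: near_eq_derive; apply: filterS fg _; exact: open_nbhs_nbhs.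
Qed.

Lemma C_on_sub (R : realType) (V W : normedModType R) (r : nat) (U U' : set V)
    (f : V -> W) : U' `<=` U -> C_on r U f -> C_on r U' f.
Proof.
move=> UU; elim: r f => [|r IH] f /=; first by move=> cf x /UU; exact: cf.
by move=> [df Df]; split=> [x /UU|v]; [exact: df|exact: IH].
Qed.

Lemma C_on_continuous (R : realType) (V W : normedModType R) (r : nat) (U : set V)
    (f : V -> W) x : C_on r U f -> U x -> {for x, continuous f}.
Proof.
by case: r => [|r] /=; [exact|move=> [df _] Ux; exact/differentiable_continuous/df].
Qed.

Lemma C_onW (R : realType) (V W : normedModType R) (r : nat) (U : set V)
    (f : V -> W) : C_on r.+1 U f -> C_on r U f.
Proof.
elim: r f => [|r IH] f.
  by move=> Cf x; exact: C_on_continuous Cf.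
by move=> [df Df]; split => // v; exact/IH/Df.
Qed.

Lemma C_on_cst (R : realType) (V W : normedModType R) (r : nat) (U : set V)
    (a : W) : C_on r U (fun=> a).
Proof.
elim: r a => [|r IH] a /=; first by move=> x _; exact: cvg_cst.
split=> [x _|v]; first exact: differentiable_cst.
rewrite (_ : 'D_v _ = fun=> 0) //; apply/funext => x; exact: derive_cst.
Qed.

Lemma C_onD (R : realType) (V W : normedModType R) (r : nat) (U : set V)
    (f g : V -> W) : open U -> C_on r U f -> C_on r U g ->
  C_on r U (fun x => f x + g x).
Proof.
move=> oU; elim: r f g => [|r IH] f g /=.
  by move=> cf cg x Ux; apply: cvgD; [exact: cf|exact: cg].
move=> [df Df] [dg Dg]; split=> [x Ux|v].
  by apply: differentiableD; [exact: df|exact: dg].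
apply: C_on_ext (IH _ _ (Df v) (Dg v)) => // x Ux.
by rewrite -deriveD //; apply: diff_derivable; [exact: df|exact: dg].
Qed.

Lemma C_onM (R : realType) (V : normedModType R) (r : nat) (U : set V)
    (f g : V -> R) : open U -> C_on r U f -> C_on r U g ->
  C_on r U (fun x => f x * g x).
Proof.
move=> oU; elim: r f g => [|r IH] f g.
  by move=> cf cg x Ux; apply: cvgM; [exact: cf|exact: cg].
move=> Cf Cg; have /C_onS[df Df] := Cf; have /C_onS[dg Dg] := Cg; apply/C_onS; split=> [x Ux|v].
  by apply: differentiableM; [exact: df|exact: dg].
apply: C_on_ext (C_onD oU (IH _ _ (C_onW Cf) (Dg v)) (IH _ _ (C_onW Cg) (Df v))) => // x Ux.
have -> : (fun y => f y * g y) = f * g by [].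
by rewrite deriveM //; apply: diff_derivable; [exact: df|exact: dg].
Qed.

(** Bootstrap: the derivative of [f^-1] is [- (f^-1)^2] times that of [f], so class [r] of [f^-1]
    itself yields class [r.+1]. The square root is treated below by the same device. *)
Lemma C_onV (R : realType) (V : normedModType R) (r : nat) (U : set V)
    (f : V -> R) : open U -> (forall x, U x -> f x != 0) -> C_on r U f ->
  C_on r U (fun x => (f x)^-1).
Proof.
move=> oU f0; elim: r => [|r IH].
  by move=> cf x Ux; apply: cvgV; [exact: f0|exact: cf].
move=> Cf; have /C_onS[df Df] := Cf; apply/C_onS; split=> [x Ux|v].
  by apply: differentiableV; [exact: df|exact: f0].
have Ci := IH (C_onW Cf).
apply: C_on_ext (C_onM oU (C_onM oU (C_onM oU Ci Ci) (Df v)) (@C_on_cst R V R r U (-1))) => // x Ux.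
rewrite deriveV ?f0 //; last exact/diff_derivable/df.
by rewrite /GRing.scale /= expr2 invfM; ring.
Qed.

Lemma C_on_sum (R : realType) (V W : normedModType R) (r : nat) (U : set V)
    (I : Type) (s : seq I) (P : pred I) (f : I -> V -> W) : open U ->
  (forall i, P i -> C_on r U (f i)) -> C_on r U (fun x => \sum_(i <- s | P i) f i x).
Proof.
move=> oU Cf; elim: s => [|i s IH].
  apply: C_on_ext (C_on_cst r U 0) => // x _; by rewrite big_nil.
have [Pi|nPi] := boolP (P i).
  by apply: C_on_ext (C_onD oU (Cf i Pi) IH) => // x _; rewrite big_cons Pi.
by apply: C_on_ext IH => // x _; rewrite big_cons (negbTE nPi).
Qed.

Lemma C_on_prod (R : realType) (V : normedModType R) (r : nat) (U : set V)
    (I : Type) (s : seq I) (P : pred I) (f : I -> V -> R) : open U ->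
  (forall i, P i -> C_on r U (f i)) -> C_on r U (fun x => \prod_(i <- s | P i) f i x).
Proof.
move=> oU Cf; elim: s => [|i s IH].
  apply: C_on_ext (@C_on_cst R V R r U 1) => // x _; by rewrite big_nil.
have [Pi|nPi] := boolP (P i).
  by apply: C_on_ext (C_onM oU (Cf i Pi) IH) => // x _; rewrite big_cons Pi.
by apply: C_on_ext IH => // x _; rewrite big_cons (negbTE nPi).
Qed.

Lemma C_on_det (R : realType) (V : normedModType R) (r : nat) (U : set V)
    (n : nat) (B : V -> 'M[R]_n) : open U ->
  (forall i j, C_on r U (fun x => B x i j)) -> C_on r U (fun x => \det (B x)).
Proof.
move=> oU CB; rewrite /determinant; apply: C_on_sum => // s _.
apply: C_onM => //; first exact: C_on_cst.
exact: C_on_prod.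
Qed.

(** Cramer's formula: the entries of the inverse are cofactors divided by the determinant. *)
Lemma C_on_invmx (R : realType) (V : normedModType R) (r : nat) (U : set V)
    (n : nat) (B : V -> 'M[R]_n) : open U ->
  (forall x, U x -> B x \in unitmx) ->
  (forall i j, C_on r U (fun x => B x i j)) ->
  forall i j, C_on r U (fun x => invmx (B x) i j).
Proof.
move=> oU uB CB i j.
have Cc : C_on r U (fun x => cofactor (B x) j i).
  rewrite /cofactor; apply: C_onM => //; first exact: C_on_cst.
  apply: C_on_det => // a b.
  by apply: C_on_ext (CB (lift j a) (lift i b)) => // x _; rewrite !mxE.
have Ci : C_on r U (fun x => (\det (B x))^-1).
  by apply: C_onV (C_on_det oU CB) => // x /uB; rewrite unitmxE unitfE.
apply: C_on_ext (C_onM oU Ci Cc) => // x Ux.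
by rewrite /invmx uB // !mxE.
Qed.

Lemma C_on_coord (R : realType) (V : normedModType R) (r : nat) (U : set V)
    (m n : nat) (f : V -> 'M[R]_(m, n)) (i : 'I_m) (j : 'I_n) : open U ->
  C_on r U f -> C_on r U (fun x => f x i j).
Proof.
move=> oU; elim: r f => [|r IH] f.
  move=> cf x Ux.
  by apply: (@continuous_comp _ _ _ f (fun M : 'M[R]_(m, n) => M i j));
    [exact: cf|exact: coord_continuous].
move=> /C_onS[df Df]; apply/C_onS; split=> [x Ux|v].
  by apply: (@differentiable_comp _ _ _ _ f (fun M : 'M[R]_(m, n) => M i j));
    [exact: df|exact: differentiable_coord].
apply: C_on_ext (IH _ (Df v)) => // x Ux.
by rewrite derive_mx ?mxE//; exact/diff_derivable/df.
Qed.

Lemma C_on_mx (R : realType) (V : normedModType R) (r : nat) (U : set V)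
    (m n : nat) (f : V -> 'M[R]_(m, n)) : open U ->
  (forall i j, C_on r U (fun x => f x i j)) -> C_on r U f.
Proof.
move=> oU; elim: r f => [|r IH] f Cf.
  move=> x Ux; apply/cvgrPdist_le => e e0; near=> y.
  rewrite [X in X <= _]/Num.Def.normr/= mx_normrE (bigmax_le _ (ltW e0))//= => i _.
  rewrite !mxE/=; move: i; near: y; apply: filter_forall => /= i.
  exact: ((cvgrPdist_le _ _).1 (Cf i.1 i.2 x Ux)).
have df i j x : U x -> differentiable (fun x => f x i j) x.
  by move=> Ux; have /C_onS[d _] := Cf i j; exact: d.
have dfr x : U x -> differentiable f x.
  move=> Ux.
  have -> : f = \sum_(k : 'I_m * 'I_n)
      ((fun x => f x k.1 k.2 *: delta_mx k.1 k.2) : V -> 'M[R]_(m,n)).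
    apply/funext => y; rewrite fct_sumE.
    by rewrite [LHS]matrix_sum_delta pair_bigA.
  elim/big_rec: _ => [|k g _ dg]; first exact: differentiable_cst.
  by apply: differentiableD => //; apply: differentiableZl; exact: df.
apply/C_onS; split=> [//|v]; apply: IH => i j.
have /C_onS[_ /(_ v)] := Cf i j.
by apply: C_on_ext => // x Ux; rewrite derive_mx ?mxE//; exact/diff_derivable/dfr.
Unshelve. all: by end_near. Qed.

(** [C_on] speaks of derivatives in fixed directions, while the chain rule differentiates [f] in the
    moving direction ['D_v g x]. Expanding this direction in the standard basis leaves fixed
    directions with moving coefficients, as the induction in [C_on_comp] requires. *)
Lemma derive_comp_rV (R : realType) (V W : normedModType R) (m : nat)
    (f : 'rV[R]_m -> W) (g : V -> 'rV[R]_m) (x v : V) :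
  differentiable g x -> differentiable f (g x) ->
  'D_v (f \o g) x = \sum_j ('D_v g x) 0 j *: 'D_(delta_mx 0 j) f (g x).
Proof.
move=> dg df; rewrite deriveE; last exact: differentiable_comp.
rewrite diff_comp //= -(deriveE v dg) [in LHS](row_sum_delta ('D_v g x)) linear_sum.
by apply: eq_bigr => j _; rewrite linearZ /= (deriveE _ df).
Qed.

Lemma C_on_comp (R : realType) (V : normedModType R) (m r : nat)
    (U : set V) (U' : set 'rV[R]_m) (f : 'rV[R]_m -> R) (g : V -> 'rV[R]_m) :
  open U -> (forall x, U x -> U' (g x)) ->
  C_on r U' f -> C_on r U g -> C_on r U (f \o g).
Proof.
move=> oU gU; elim: r f => [|r IH] f.
  by move=> cf cg x Ux; apply: continuous_comp; [exact: cg|exact/cf/gU].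
move=> /C_onS[df Df] Cg; have /C_onS[dg Dg] := Cg; apply/C_onS; split=> [x Ux|v].
  by apply: differentiable_comp; [exact: dg|exact/df/gU].
have : C_on r U (fun x => \sum_j ('D_v g x) 0 j * 'D_(delta_mx 0 j) f (g x)).
  apply: C_on_sum => // j _; apply: C_onM => //; first exact: C_on_coord.
  exact: (IH _ (Df _) (C_onW Cg)).
apply: C_on_ext => // x Ux.
by rewrite derive_comp_rV //; [exact: dg|exact/df/gU].
Qed.

Lemma C_on_comp_mx (R : realType) (V : normedModType R) (m p q r : nat)
    (U : set V) (U' : set 'rV[R]_m) (f : 'rV[R]_m -> 'M[R]_(p, q)) (g : V -> 'rV[R]_m) :
  open U -> open U' -> (forall x, U x -> U' (g x)) ->
  C_on r U' f -> C_on r U g -> C_on r U (f \o g).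
Proof.
move=> oU oU' gU Cf Cg; apply: C_on_mx => // i j.
exact: (C_on_comp oU gU (C_on_coord i j oU' Cf) Cg).
Qed.

Lemma continuous_linear_rV (R : realType) (m : nat) (W : normedModType R)
    (L : {linear 'rV[R]_m -> W}) : continuous L.
Proof.
have -> : (L : _ -> _) = fun x => \sum_j x 0 j *: L (delta_mx 0 j).
  apply/funext => x; rewrite [in LHS](row_sum_delta x) linear_sum.
  by apply: eq_bigr => j _; rewrite linearZ.
suff : C_on 0 setT (fun x : 'rV[R]_m => \sum_j x 0 j *: L (delta_mx 0 j)).
  by move=> /= H x; exact: H.
apply: C_on_sum => [|j _ x _]; first exact: openT.
apply: differentiable_continuous; apply: differentiableZl.
exact: differentiable_coord.
Qed.

Lemma smooth_linear (R : realType) (m : nat) (W : normedModType R) (U : set 'rV[R]_m)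
    (L : {linear 'rV[R]_m -> W}) : smooth_on U L.
Proof.
have cL := @continuous_linear_rV R m W L.
case=> [|r]; first by move=> x _; exact: cL.
apply/C_onS; split=> [x _|v]; first exact: linear_differentiable.
rewrite (_ : 'D_v L = fun=> L v); first exact: C_on_cst.
by apply/funext => x; rewrite deriveE ?diff_lin//; exact: linear_differentiable.
Qed.

Lemma C_on_sqrt (R : realType) (V : normedModType R) (r : nat) (U : set V)
    (f : V -> R) : open U -> (forall x, U x -> 0 < f x) -> C_on r U f ->
  C_on r U (fun x => Num.sqrt (f x)).
Proof.
move=> oU f0; elim: r => [|r IH].
  move=> cf x Ux; apply: (@continuous_comp _ _ _ f Num.sqrt); first exact: cf.
  exact: sqrt_continuous.
move=> Cf; have /C_onS[df Df] := Cf.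
have dsqrt x : U x -> differentiable (Num.sqrt : R -> R) (f x).
  move=> Ux; apply/derivable1_diffP.
  by have [] := is_derive1_sqrt (f0 x Ux).
apply/C_onS; split=> [x Ux|v].
  by apply: (@differentiable_comp _ _ _ _ f Num.sqrt); [exact: df|exact: dsqrt].
have Ci : C_on r U (fun x => (2 * Num.sqrt (f x))^-1).
  apply: C_onV => // [x Ux|]; last by apply: C_onM (IH (C_onW Cf)) => //; exact: C_on_cst.
  by rewrite mulf_neq0 // gt_eqF // sqrtr_gt0; exact: f0.
apply: C_on_ext (C_onM oU Ci (Df v)) => // x Ux.
rewrite [RHS]deriveE; last first.
  by apply: (@differentiable_comp _ _ _ _ f Num.sqrt); [exact: df|exact: dsqrt].
rewrite (@diff_comp _ _ _ _ f Num.sqrt)//=; [|exact: df|exact: dsqrt].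
rewrite -(deriveE v (df x Ux)).
rewrite diff1E; last exact: dsqrt.
have [_ /= Dd] := is_derive1_sqrt (f0 x Ux).
by rewrite derive1E Dd /GRing.scale/= mulrC.
Qed.

(** * The inverse function theorem *)

Lemma ball_convex (R : realType) (V : normedModType R) (x0 x y : V) (r s : R) :
  ball x0 r x -> ball x0 r y -> 0 <= s <= 1 -> ball x0 r (x + s *: (y - x)).
Proof.
rewrite -ball_normE /= => xr yr /andP[s0 s1].
have -> : x0 - (x + s *: (y - x)) = (1 - s) *: (x0 - x) + s *: (x0 - y).
  have -> : y - x = (x0 - x) - (x0 - y) by rewrite opprB [RHS]addrC addrA subrK.
  rewrite opprD addrA scalerBr scalerBl scale1r opprB.
  by rewrite addrA addrAC.
apply: (le_lt_trans (ler_normD _ _)); rewrite !normrZ ger0_norm ?subr_ge0// (ger0_norm s0).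
have [->|s_n0] := eqVneq s 0; first by rewrite subr0 mul1r mul0r addr0.
have sp : 0 < s by rewrite lt_def s_n0.
have : s * `|x0 - y| < s * r by rewrite ltr_pM2l.
have : (1 - s) * `|x0 - x| <= (1 - s) * r by rewrite ler_wpM2l ?subr_ge0// ltW.
nra.
Qed.

Lemma is_derive_line (R : realType) (V W : normedModType R) (f : V -> W) (x v : V) (s : R) :
  differentiable f (x + s *: v) ->
  is_derive s 1 (fun s => f (x + s *: v)) ('D_v f (x + s *: v)).
Proof.
move=> df.
set F := fun s => _.
have E : (fun h : R => h^-1 *: ((F \o shift s) (h *: 1) - F s)) =
    (fun h => h^-1 *: ((f \o shift (x + s *: v)) (h *: v) - f (x + s *: v))).
  by apply/funext => h; rewrite /F /= scalerDl addrCA [h *: 1]mulr1.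
apply: DeriveDef; first by rewrite /derivable E; exact: diff_derivable.
by rewrite /derive E.
Qed.

Lemma mean_value_rV (R : realType) (m : nat) (f : 'rV[R]_m -> R) (x0 x y : 'rV[R]_m) (r K : R) :
  (forall z, ball x0 r z -> differentiable f z) ->
  (forall z v, ball x0 r z -> `|'D_v f z| <= K * `|v|) ->
  ball x0 r x -> ball x0 r y -> `|f y - f x| <= K * `|y - x|.
Proof.
move=> df Df xr yr.
pose F s := f (x + s *: (y - x)).
have inb s : 0 <= s <= 1 -> ball x0 r (x + s *: (y - x)) by exact: ball_convex.
have dF (s : R) : 0 <= s <= 1 -> is_derive s 1 F ('D_(y - x) f (x + s *: (y - x))).
  by move=> s01; apply: is_derive_line; apply: df; exact: inb.
have [| |c] := @MVT_segment R F (fun s => 'D_(y - x) f (x + s *: (y - x))) 0 1 ler01.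
  by move=> s; rewrite in_itv /= => /andP[a b]; apply: dF; rewrite !ltW.
  apply: derivable_within_continuous => s; rewrite in_itv /= => s01.
  by have [] := dF s s01.
rewrite in_itv /= => c01.
rewrite /F scale0r addr0 scale1r [x + (y - x)]addrC subrK subr0 mulr1 => ->.
by apply: Df; exact: inb.
Qed.

Lemma derive_rV (R : realType) (m : nat) (W : normedModType R) (f : 'rV[R]_m -> W)
    (x v : 'rV[R]_m) : differentiable f x ->
  'D_v f x = \sum_j v 0 j *: 'D_(delta_mx 0 j) f x.
Proof.
move=> df; rewrite deriveE // [in LHS](row_sum_delta v) linear_sum.
by apply: eq_bigr => j _; rewrite linearZ /= (deriveE _ df).
Qed.

Lemma coord_le_norm (R : realType) (m n : nat) (v : 'M[R]_(m, n)) (i : 'I_m) (j : 'I_n) :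
  `|v i j| <= `|v|.
Proof.
rewrite [leRHS]/Num.Def.normr/= mx_normrE.
exact: (le_bigmax _ (fun i : 'I_m * 'I_n => `|v i.1 i.2|) (i, j)).
Qed.

Lemma ball_near_right (R : realType) (V : normedModType R) (x : V) (P : set V) :
  (\forall y \near x, P y) -> \forall r \near 0^'+, ball x r `<=` P.
Proof.
move=> /nbhs_ballP[e /= e0 eP]; near=> r.
apply: subset_trans eP; apply: le_ball; near: r; exact: nbhs_right_le.
Unshelve. all: by end_near. Qed.

(** The partial derivatives are continuous and vanish at [x0], so the mean value inequality gives an
    arbitrarily small Lipschitz constant on small balls. This serves twice: to make [f - id] a
    contraction in the inverse function theorem, and to bound the height near a critical point on
    the equator. *)
Lemma small_derivative_lipschitz (R : realType) (m : nat) (U : set 'rV[R]_m) (f : 'rV[R]_m -> R)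
    (x0 : 'rV[R]_m) (e : R) : open U -> U x0 -> C_on 1 U f ->
  (forall v, 'D_v f x0 = 0) -> 0 < e ->
  \forall r \near 0^'+, forall x y, ball x0 r x -> ball x0 r y ->
    `|f y - f x| <= e * `|y - x|.
Proof.
move=> oU Ux0 /C_onS[df Df] D0 e0.
(* A bound for the operator norm of the differential, since each coordinate of [v] is at most [|v|]
   in the sup norm. *)
pose C x := \sum_(j < m) `|'D_(delta_mx 0 j) f x|.
have Cle x v : U x -> `|'D_v f x| <= C x * `|v|.
  move=> Ux; rewrite derive_rV; last exact: df.
  apply: (le_trans (ler_norm_sum _ _ _)); rewrite mulr_suml ler_sum// => j _.
  by rewrite normrZ mulrC ler_wpM2l// coord_le_norm.
have cC : {for x0, continuous C}.
  have aux (s : seq 'I_m) : {for x0, continuous (fun x => \sum_(j <- s) `|'D_(delta_mx 0 j) f x|)}.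
    elim: s => [|j s IH].
      rewrite (_ : (fun _ => _) = cst 0); last by apply/funext => x; rewrite big_nil.
      exact: cst_continuous.
    rewrite (_ : (fun _ => _) = (fun x => `|'D_(delta_mx 0 j) f x|) +
        (fun x => \sum_(j <- s) `|'D_(delta_mx 0 j) f x|)).
      apply: continuousD => //; apply: (@continuous_comp _ _ _ ('D_(delta_mx 0 j) f) Num.Def.normr).
        exact: (Df (delta_mx 0 j) x0 Ux0).
      exact: norm_continuous.
    by apply/funext => x; rewrite big_cons.
  exact: aux.
have Ce : \forall x \near x0, C x < e.
  have C0 : C x0 = 0 by rewrite /C big1// => j _; rewrite D0 normr0.
  by have := @cvgr_lt _ _ _ _ C (C x0) cC e; rewrite C0; apply.
have bU : \forall x \near x0, U x by exact: open_nbhs_nbhs.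
near=> r => x y xr yr.
apply: (@mean_value_rV _ _ f x0 x y r) => //.
  by move=> z zr; apply: df; apply: (near (ball_near_right bU) r _ z zr).
move=> z v zr; have Uz : U z by apply: (near (ball_near_right bU) r _ z zr).
apply: (le_trans (Cle z v Uz)); rewrite ler_wpM2r// ltW//.
by apply: (near (ball_near_right Ce) r _ z zr).
Unshelve. all: by end_near. Qed.

Lemma small_derivative_lipschitz_mx (R : realType) (m n : nat) (U : set 'rV[R]_m)
    (f : 'rV[R]_m -> 'rV[R]_n)
    (x0 : 'rV[R]_m) (e : R) : open U -> U x0 -> C_on 1 U f ->
  (forall v, 'D_v f x0 = 0) -> 0 < e ->
  \forall r \near 0^'+, forall x y, ball x0 r x -> ball x0 r y ->
    `|f y - f x| <= e * `|y - x|.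
Proof.
move=> oU Ux0 Cf D0 e0; have /C_onS[df _] := Cf.
have H : \forall r \near 0^'+, forall ij : 'I_1 * 'I_n, forall x y, ball x0 r x -> ball x0 r y ->
    `|f y ij.1 ij.2 - f x ij.1 ij.2| <= e * `|y - x|.
  apply: filter_forall => -[i j].
  apply: (small_derivative_lipschitz oU Ux0 (C_on_coord i j oU Cf)) => // v.
  have := derive_mx (diff_derivable (v := v) (df x0 Ux0)); rewrite D0.
  by move=> /matrixP/(_ i j); rewrite !mxE.
apply: filterS H => r H x y xr yr.
rewrite [leLHS]/Num.Def.normr/= mx_normrE bigmax_le ?mulr_ge0// ?ltW// => -[i j] _.
by rewrite !mxE; exact: (H (i, j)).
Qed.

Lemma near_lipschitz_continuous (R : realType) (V W : normedModType R) (f : V -> W)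
    (x : V) (K : R) : (\forall y \near x, `|f y - f x| <= K * `|y - x|) ->
  {for x, continuous f}.
Proof.
move=> flip; apply/cvgrPdist_le => e e0; near=> y.
have K1 : 0 < `|K| + 1 by rewrite ltr_wpDl.
rewrite distrC; apply: (@le_trans _ _ (K * `|y - x|)); first by near: y.
have : `|x - y| <= e / (`|K| + 1) by near: y; apply: cvgr_dist_le; rewrite ?divr_gt0.
rewrite distrC ler_pdivlMr // => h.
have : K * `|y - x| <= `|K| * `|y - x| by rewrite ler_wpM2r // ler_norm.
have := normr_ge0 (y - x); lra.
Unshelve. all: by end_near. Qed.

Lemma C_on_jacobian (R : realType) (m n r : nat) (U : set 'rV[R]_m)
    (f : 'rV[R]_m -> 'rV[R]_n) i j :
  open U -> C_on r.+1 U f -> C_on r U (fun x => jacobian f x i j).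
Proof.
move=> oU /C_onS[df Df]; apply: C_on_ext (C_on_coord 0 j oU (Df (delta_mx 0 i))) => // x Ux.
by rewrite (deriveEjacobian _ (df x Ux)) -rowE mxE.
Qed.

Lemma open_preimage_on (R : realType) (V V' : normedModType R) (W : set V) (Y : set V')
    (g : V -> V') :
  open W -> open Y -> (forall x, W x -> {for x, continuous g}) ->
  open (W `&` g @^-1` Y).
Proof.
move=> oW oY cg; rewrite openE => x [Wx Yx].
apply: filterI; first exact: open_nbhs_nbhs.
by apply: (cg x Wx); exact: open_nbhs_nbhs.
Qed.

(* At a minimum x of |f - y| on the closed ball of radius r / 2, replacing x by
   y - (f x - x) would halve the distance. *)
Lemma contraction_surjective (R : realType) (m : nat) (f : 'rV[R]_m -> 'rV[R]_m)
    (x0 y : 'rV[R]_m) (r : R) :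
  (forall x x', ball x0 r x -> ball x0 r x' ->
    `|(f x' - x') - (f x - x)| <= 2^-1 * `|x' - x|) ->
  `|y - f x0| < r / 4 -> exists2 x, ball x0 r x & f x = y.
Proof.
move=> hlip yr.
have r0 : 0 < r by have := normr_ge0 (y - f x0); lra.
have b0 : ball x0 r x0 by exact: ballxx.
pose K := closed_ball x0 (r / 2).
have KE : K = closed_ball_ Num.Def.normr x0 (r / 2) by rewrite /K closed_ballE // divr_gt0.
have Kb : K `<=` ball x0 r.
  by rewrite KE -ball_normE => x /= xr; apply: (le_lt_trans xr); lra.
have cK : compact K.
  apply: bounded_closed_compact; last exact: closed_ball_closed.
  exists (`|x0| + r / 2); split; [exact: num_real|] => e e0 x; rewrite KE /= => xr.
  by rewrite -[x](subKr x0) ltW // (le_lt_trans (ler_normB _ _))// (le_lt_trans _ e0)// lerD2l.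
pose q x := `|f x - y|.
have fsub x x' : ball x0 r x -> ball x0 r x' -> `|f x' - f x| <= 2 * `|x' - x|.
  move=> xr xr'.
  rewrite (_ : f x' - f x = ((f x' - x') - (f x - x)) + (x' - x)).
    have := hlip x x' xr xr'; have := normr_ge0 (x' - x).
    by have := ler_normD ((f x' - x') - (f x - x)) (x' - x); lra.
  by apply/rowP => i; rewrite !mxE; ring.
have cq : {within K, continuous q}.
  apply: continuous_in_subspaceT => x /set_mem Kx.
  apply: (@near_lipschitz_continuous _ _ _ q x 2).
  have : nbhs x (ball x0 r) by apply: open_nbhs_nbhs; split; [exact: ball_open|exact: Kb].
  apply: filterS => x' xr'.
  apply: (le_trans (ler_dist_dist _ _)).
  rewrite (_ : f x' - y - (f x - y) = f x' - f x); last by rewrite opprB addrA subrK.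
  exact: fsub (Kb _ Kx) xr'.
have K0 : K !=set0 by exists x0; apply: closed_ballxx; rewrite divr_gt0.
have [x /set_mem Kx xmin] := compact_EVT_min K0 cK cq.
exists x; first exact: Kb.
pose x' := y - (f x - x).
(* Here the radius [r / 4] matters: the residual at [x0] and half of [|x - x0|] are each at most
   [r / 4], so the corrected point stays in the compact ball. *)
have Kx' : K x'.
  suff: `|x0 - x'| <= r / 2 by rewrite KE.
  rewrite (_ : x0 - x' = (f x0 - y) + ((f x - x) - (f x0 - x0))); last first.
    by apply/rowP => i; rewrite !mxE; ring.
  apply: (le_trans (ler_normD _ _)).
  have := hlip x0 x b0 (Kb _ Kx); have : `|x - x0| <= r / 2 by rewrite distrC; move: Kx; rewrite KE.
  rewrite (distrC (f x0)); lra.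
have := xmin x' (mem_set Kx'); rewrite /q.
have := hlip x x' (Kb _ Kx) (Kb _ Kx').
rewrite (_ : f x' - x' - (f x - x) = f x' - y); last by apply/rowP => i; rewrite !mxE; ring.
rewrite (_ : x' - x = - (f x - y)); last by apply/rowP => i; rewrite !mxE; ring.
rewrite normrN => h1 h2.
have : `|f x - y| <= 0 by have := normr_ge0 (f x - y); lra.
by rewrite normr_le0 subr_eq0 => /eqP.
Qed.

(** The Lipschitz bound on [g] turns the error [o(|g y - g y0|)] in the expansion of [f] at [g y0]
    into [o(|y - y0|)]; applying the inverse of the Jacobian then gives the expansion of [g]. *)
Lemma differentiable_inverse (R : realType) (m : nat) (f g : 'rV[R]_m -> 'rV[R]_m)
    (y0 : 'rV[R]_m) :
  differentiable f (g y0) -> jacobian f (g y0) \in unitmx ->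
  (\forall y \near y0, f (g y) = y) ->
  (\forall y \near y0, `|g y - g y0| <= 2 * `|y - y0|) ->
  differentiable g y0 /\ 'd g y0 = mulmxr (invmx (jacobian f (g y0))) :> (_ -> _).
Proof.
move=> df uJ fgE glip; set J := jacobian _ _ in uJ *.
pose L : {linear 'rV[R]_m -> 'rV[R]_m} := mulmxr (invmx J).
have cL : continuous L by exact: continuous_linear_rV.
have [k k0 Lk] : exists2 k, 0 < k & forall v, `|L v| <= k * `|v|.
  by have [k k0 Lk] := linear_lipschitz cL; exists k.
apply: (@estimate_differentiable _ _ _ g y0 L) => // e e0.
(* [k] bounds the norm of [L] and [2] is the Lipschitz constant of [g], so the final error is
   [k * (e / (2 * k)) * 2 = e] times [|h|]. *)
have e'0 : 0 < e / (2 * k) by rewrite divr_gt0 // mulr_gt0.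
have fe := differentiable_estimate df e'0.
have fgE0 := nbhs_singleton fgE.
have cg : g y @[y --> y0] --> g y0.
  exact: near_lipschitz_continuous glip.
have shiftP (P : set 'rV[R]_m) : (\forall y \near y0, P y) ->
    \forall h \near (0 : 'rV[R]_m), P (h + y0).
  rewrite (near_shift 0 y0) /=.
  by apply: filterS => h /=; rewrite subr0.
have fe' : \forall y \near y0,
    `|f (g y) - f (g y0) - 'd f (g y0) (g y - g y0)| <= e / (2 * k) * `|g y - g y0|.
  have : \forall z \near g y0,
      `|f z - f (g y0) - 'd f (g y0) (z - g y0)| <= e / (2 * k) * `|z - g y0|.
    rewrite (near_shift 0 (g y0)) /=; apply: filterS fe => h.
    by rewrite /= subr0 addrK.
  exact: cg.
near=> h.
have h1 : f (g (h + y0)) = h + y0 by near: h; exact: (shiftP _ fgE).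
have h2 : `|g (h + y0) - g y0| <= 2 * `|h|.
  have : `|g (h + y0) - g y0| <= 2 * `|h + y0 - y0| by near: h; exact: (shiftP _ glip).
  by rewrite addrK.
have h3 : `|h - 'd f (g y0) (g (h + y0) - g y0)| <= e / (2 * k) * `|g (h + y0) - g y0|.
  have : `|f (g (h + y0)) - f (g y0) - 'd f (g y0) (g (h + y0) - g y0)| <=
      e / (2 * k) * `|g (h + y0) - g y0|.
    by near: h; exact: (shiftP _ fe').
  by rewrite h1 fgE0 addrK.
set d := g (h + y0) - g y0 in h2 h3 *.
have dE : d - L h = L ('d f (g y0) d - h).
  rewrite [RHS]linearB; congr (_ - _).
  by rewrite -(deriveE _ df) deriveEjacobian //= mulmxK.
rewrite dE; apply: (le_trans (Lk _)); rewrite distrC.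
have := ler_wpM2l (ltW k0) h3.
have -> : k * (e / (2 * k) * `|d|) = e / 2 * `|d| by field; rewrite gt_eqF.
have := ler_wpM2l (ltW e0) h2.
lra.
Unshelve. all: by end_near. Qed.

(** Inverse function theorem, normalized by an identity Jacobian: [h = f - id] has zero derivative
    at [x0], hence Lipschitz constant [1 / 2] nearby. This makes [f] injective with a 2-Lipschitz
    inverse, and [contraction_surjective] provides a full ball of values. *)
Lemma local_inverse (R : realType) (m : nat) (V : set 'rV[R]_m) (f : 'rV[R]_m -> 'rV[R]_m)
    (x0 : 'rV[R]_m) : open V -> V x0 -> smooth_on V f -> jacobian f x0 = 1%:M ->
  exists (r : R) (g : 'rV[R]_m -> 'rV[R]_m),
  [/\ 0 < r, ball x0 r `<=` V,
    forall x x', ball x0 r x -> ball x0 r x' -> `|x' - x| <= 2 * `|f x' - f x|,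
    forall y, ball (f x0) (r / 4) y -> ball x0 r (g y) /\ f (g y) = y &
    smooth_on (ball (f x0) (r / 4)) g].
Proof.
move=> oV Vx0 sf J0.
pose h x := f x - x.
have df x : V x -> differentiable f x by have /C_onS[d _] := sf 1%N; exact: d.
have Ch : C_on 1 V h.
  apply: (C_onD oV (sf 1%N)).
  by have := @smooth_linear R m _ V (-%R : {linear 'rV[R]_m -> 'rV[R]_m}) 1%N.
have Dh v : 'D_v h x0 = 0.
  rewrite deriveB; [|exact/diff_derivable/df|exact: derivable_id].
  by rewrite derive_id deriveEjacobian ?J0 ?mulmx1 ?subrr //; exact: df.
have Cd : C_on 0 V (fun x => \det (jacobian f x)).
  by apply: C_on_det => // i j; exact: (C_on_jacobian i j oV (sf 1%N)).
pose V1 := V `&` [set x | \det (jacobian f x) != 0].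
have oV1 : open V1.
  have := @open_preimage_on R _ _ V [set x : R | x != 0] (fun x => \det (jacobian f x))
    oV (@open_neq R 0).
  by apply => x Vx; exact: (C_on_continuous Cd Vx).
have V1x0 : V1 x0 by split; [exact: Vx0|rewrite /= J0 det1 oner_eq0].
have V1near : nbhs x0 V1 := open_nbhs_nbhs (conj oV1 V1x0).
have half_gt0 : 0 < 2^-1 :> R by rewrite invr_gt0.
have [r [r0 [hlip rV1]]] := filter_ex (filterI (nbhs_right_gt 0)
  (filterI (small_derivative_lipschitz_mx oV Vx0 Ch Dh half_gt0) (ball_near_right V1near))).
have rV : ball x0 r `<=` V by move=> x /rV1[].
have rJ : ball x0 r `<=` [set x | \det (jacobian f x) != 0] by move=> x /rV1[].
have r40 : 0 < r / 4 by rewrite divr_gt0.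
have flip x x' : ball x0 r x -> ball x0 r x' -> `|x' - x| <= 2 * `|f x' - f x|.
  move=> xr xr'; have := hlip x x' xr xr'.
  have := ler_normB (f x' - f x) (h x' - h x).
  rewrite (_ : f x' - f x - (h x' - h x) = x' - x); first lra.
  by rewrite /h; apply/rowP => i; rewrite !mxE; ring.
(* The implication stands under the existential so that a choice function exists for all [y];
   outside the ball the condition is vacuous and the value of [g] is arbitrary. *)
have ex y : exists x, ball (f x0) (r / 4) y -> ball x0 r x /\ f x = y.
  have [yr|nyr] := pselect (ball (f x0) (r / 4) y); last by exists 0.
  have [|x xr fx] := contraction_surjective (y := y) hlip; last by exists x.
  by move: yr; rewrite -ball_normE /= distrC.
pose g y := projT1 (cid (ex y)).
have gE y : ball (f x0) (r / 4) y -> ball x0 r (g y) /\ f (g y) = y by exact: (projT2 (cid (ex y))).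
exists r, g; split => //.
set Y := ball _ _ in gE *.
have oY : open Y by exact: ball_open.
have dg y : Y y -> differentiable g y /\ 'd g y = mulmxr (invmx (jacobian f (g y))) :> (_ -> _).
  move=> Yy; have [gr fg] := gE y Yy.
  have Ynear : \forall y' \near y, Y y' by exact: open_nbhs_nbhs.
  apply: differentiable_inverse.
  - exact/df/rV.
  - by rewrite unitmxE unitfE; exact: rJ.
  - by apply: filterS Ynear => y' /gE[].
  - apply: filterS Ynear => y' /gE[gr' fg'].
    by rewrite -{2}fg' -{2}fg; exact: flip.
have gV y : Y y -> V (g y) by move=> /gE[/rV].
(* Bootstrap on the class of [g]: its derivative [v *m invmx (jacobian f (g y))] is obtained from
   [g] by smooth operations, so class [n] of [g] gives class [n.+1]. *)
elim=> [|n IH].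
  by move=> y /dg[dy _]; exact: differentiable_continuous.
apply/C_onS; split=> [y /dg[]//|v].
have : C_on n Y (fun y => v *m invmx (jacobian f (g y))).
  apply: C_on_mx => // i j.
  have : C_on n Y (fun y => \sum_l v i l * invmx (jacobian f (g y)) l j).
    apply: C_on_sum => // l _; apply: C_onM => //; first exact: C_on_cst.
    apply: C_on_invmx => // [y /gE[gr _]|a b].
      by rewrite unitmxE unitfE; exact: rJ.
    exact: (C_on_comp oY gV (C_on_jacobian a b oV (sf n.+1)) IH).
  by apply: C_on_ext => // y _; rewrite mxE.
apply: C_on_ext => // y Yy; have [dy dE] := dg y Yy.
by rewrite deriveE // dE.
Qed.

(** * Orthonormal frames *)

Lemma dotE (R : realType) (n : nat) (u v : 'rV[R]_n) : dot u v = (u *m v^T) 0 0.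
Proof. by rewrite mxE; apply: eq_bigr => i _; rewrite mxE. Qed.

Lemma mul_rV_tr (R : realType) (n : nat) (u v : 'rV[R]_n) : u *m v^T = (dot u v)%:M.
Proof. by apply/matrixP => i j; rewrite !ord1 -dotE mxE eqxx mulr1n. Qed.

Lemma dotC (R : realType) (n : nat) (u v : 'rV[R]_n) : dot u v = dot v u.
Proof. by apply: eq_bigr => i _; rewrite mulrC. Qed.

Lemma dotDl (R : realType) (n : nat) (u v w : 'rV[R]_n) : dot (u + v) w = dot u w + dot v w.
Proof. by rewrite !dotE mulmxDl mxE. Qed.

Lemma dotZl (R : realType) (n : nat) (a : R) (u w : 'rV[R]_n) : dot (a *: u) w = a * dot u w.
Proof. by rewrite !dotE -scalemxAl mxE. Qed.

Lemma dotNl (R : realType) (n : nat) (u w : 'rV[R]_n) : dot (- u) w = - dot u w.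
Proof. by rewrite -scaleN1r dotZl mulN1r. Qed.

Lemma dotBl (R : realType) (n : nat) (u v w : 'rV[R]_n) : dot (u - v) w = dot u w - dot v w.
Proof. by rewrite dotDl dotNl. Qed.

Lemma dotDr (R : realType) (n : nat) (u v w : 'rV[R]_n) : dot w (u + v) = dot w u + dot w v.
Proof. by rewrite dotC dotDl !(dotC w). Qed.

Lemma dotZr (R : realType) (n : nat) (a : R) (u w : 'rV[R]_n) : dot w (a *: u) = a * dot w u.
Proof. by rewrite dotC dotZl dotC. Qed.

Lemma dotNr (R : realType) (n : nat) (u w : 'rV[R]_n) : dot w (- u) = - dot w u.
Proof. by rewrite dotC dotNl dotC. Qed.

Lemma dotBr (R : realType) (n : nat) (u v w : 'rV[R]_n) : dot w (u - v) = dot w u - dot w v.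
Proof. by rewrite dotDr dotNr. Qed.

Lemma dot_ge0 (R : realType) (n : nat) (u : 'rV[R]_n) : 0 <= dot u u.
Proof. by apply: sumr_ge0 => i _; rewrite -expr2 sqr_ge0. Qed.

Lemma dot_eq0 (R : realType) (n : nat) (u : 'rV[R]_n) : (dot u u == 0) = (u == 0).
Proof.
apply/eqP/eqP => [|->]; last by rewrite dotE mul0mx mxE.
move/eqP; rewrite psumr_eq0; last by move=> i _; rewrite -expr2 sqr_ge0.
move=> /allP h; apply/rowP => i; rewrite mxE.
by have := h i (mem_index_enum _); rewrite mulf_eq0 orbb => /eqP.
Qed.

Lemma dot_gt0 (R : realType) (n : nat) (u : 'rV[R]_n) : u != 0 -> 0 < dot u u.
Proof. by rewrite lt_def dot_ge0 dot_eq0 => ->. Qed.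

Lemma col_mx_orthonormal (R : realType) (l n : nat) (v : 'rV[R]_n) (W : 'M[R]_(l, n)) :
  dot v v = 1 -> W *m W^T = 1%:M -> W *m v^T = 0 ->
  col_mx v W *m (col_mx v W)^T = 1%:M.
Proof.
move=> vv WW Wv; rewrite tr_col_mx mul_col_row WW Wv mul_rV_tr vv.
have -> : v *m W^T = 0 by rewrite -(trmxK v) -trmx_mul Wv trmx0.
by rewrite -scalar_mx_block.
Qed.

Lemma mul_col_mx_eq0 (R : realType) (r l n p : nat) (A : 'M[R]_(r, n)) (B : 'M[R]_(l, n))
    (C : 'M[R]_(n, p)) : col_mx A B *m C = 0 -> A *m C = 0 /\ B *m C = 0.
Proof. by rewrite mul_col_mx => /eqP; rewrite col_mx_eq0 => /andP[/eqP ? /eqP ?]. Qed.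

Lemma mul_tr_col_mx (R : realType) (l n : nat) (z f : 'rV[R]_n) (B : 'M[R]_(l, n)) :
  z *m (col_mx f B)^T *m col_mx f B = dot z f *: f + z *m B^T *m B.
Proof. by rewrite tr_col_mx mul_mx_row mul_row_col mul_rV_tr mul_scalar_mx. Qed.

Lemma col_mx_mul_eq0 (R : realType) (r l n p : nat) (A : 'M[R]_(r, n)) (B : 'M[R]_(l, n))
    (C : 'M[R]_(n, p)) : A *m C = 0 -> B *m C = 0 -> col_mx A B *m C = 0.
Proof. by move=> A0 B0; rewrite mul_col_mx A0 B0 col_mx0. Qed.

Lemma mxtrace_mul_col_mx (R : realType) (l n : nat) (a b : 'rV[R]_n) (V W : 'M[R]_(l, n))
    (P : 'M[R]_n) :
  \tr (col_mx a V *m P *m (col_mx b W)^T) = dot (a *m P) b + \tr (V *m P *m W^T).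
Proof.
by rewrite mul_col_mx tr_col_mx mul_col_row mxtrace_block mul_rV_tr mxtrace_scalar.
Qed.

(** One row is added at a time: fewer than [n] rows leave a nonzero vector orthogonal to all of
    them, which is then normalized. *)
Lemma orthonormal_extension (R : realType) (r l n : nat) (B : 'M[R]_(r, n)) :
  (r + l <= n)%N -> exists W : 'M[R]_(l, n), W *m W^T = 1%:M /\ B *m W^T = 0.
Proof.
elim: l => [|l IH] rl.
  by exists 0; split; apply/matrixP => i j; [case: i|case: j].
have [W [WW BW]] := IH (leq_trans (leq_add (leqnn r) (leqnSn l)) rl).
pose C := (col_mx B W)^T.
have rC : (\rank C < n)%N.
  by apply: leq_ltn_trans (rank_leq_col _) _; rewrite -addnS.
have kC : kermx C != 0 by rewrite -mxrank_eq0 mxrank_ker subn_eq0 -ltnNge.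
pose z := nz_row (kermx C).
have z0 : z != 0 by rewrite nz_row_eq0.
have zC : z *m C = 0 by apply/sub_kermxP; exact: nz_row_sub.
have {}zC : col_mx B W *m z^T = 0.
  by rewrite -[LHS]trmxK trmx_mul trmxK zC trmx0.
have [Bz Wz] := mul_col_mx_eq0 zC.
have zz := dot_gt0 z0.
pose t := (Num.sqrt (dot z z))^-1.
exists (col_mx (t *: z) W); split.
  apply: col_mx_orthonormal => //.
    rewrite dotZl dotZr mulrA -expr2 /t exprVn sqr_sqrtr ?ltW// mulVf// gt_eqF //.
  by rewrite linearZ -scalemxAr Wz scaler0.
rewrite (tr_col_mx (t *: z) W) (mul_mx_row B (t *: z)^T W^T) BW.
by rewrite linearZ -scalemxAr Bz scaler0 row_mx0.
Qed.

(* In an orthonormal basis whose last vector is nu, x = (x1, x2, u), y = (y1, y2, v) and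
   P = diag (1, 1, d); then (a1, a2, e) = x * P y and (b1, b2, e) = P x * y are cross
   products, s = <x, P y>, and the last sum is the pairing of the two through P. *)
Lemma weighted_cross_product_bound (R : realType) (x1 x2 u y1 y2 v d s : R) :
  1 < d -> 0 < u -> 0 < v -> 0 < s < 1 ->
  x1 ^+ 2 + x2 ^+ 2 + u ^+ 2 = 1 -> y1 ^+ 2 + y2 ^+ 2 + v ^+ 2 = 1 ->
  s = x1 * y1 + x2 * y2 + d * u * v ->
  let a1 := x2 * (d * v) - u * y2 in let a2 := u * y1 - x1 * (d * v) in
  let b1 := x2 * v - d * u * y2 in let b2 := d * u * y1 - x1 * v in
  let e := x1 * y2 - x2 * y1 in
  [/\ 0 < a1 ^+ 2 + a2 ^+ 2 + e ^+ 2, 0 < b1 ^+ 2 + b2 ^+ 2 + e ^+ 2 &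
    s * (Num.sqrt (a1 ^+ 2 + a2 ^+ 2 + e ^+ 2) * Num.sqrt (b1 ^+ 2 + b2 ^+ 2 + e ^+ 2)) <
      a1 * b1 + a2 * b2 + d * e ^+ 2].
Proof.
move=> d1 u0 v0 /andP[s0 s1] hx hy hs a1 a2 b1 b2 e.
pose q := d ^+ 2 - 1; pose de := 1 - s ^+ 2.
have hx' : x1 ^+ 2 + x2 ^+ 2 = 1 - u ^+ 2 by rewrite -hx; ring.
have hy' : y1 ^+ 2 + y2 ^+ 2 = 1 - v ^+ 2 by rewrite -hy; ring.
have q0 : 0 < q by rewrite /q; nra.
have de0 : 0 < de by rewrite /de; nra.
(* Lagrange's identity: the squared length of the cross product of [x] and [P y] is
   [|x|^2 |P y|^2 - s^2], and [|P y|^2 = 1 + q * v^2]. The next identity exchanges the roles of [x]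
   and [y]. *)
have aE : a1 ^+ 2 + a2 ^+ 2 + e ^+ 2 = de + q * v ^+ 2.
  transitivity ((x1 ^+ 2 + x2 ^+ 2 + u ^+ 2) * (y1 ^+ 2 + y2 ^+ 2 + (d * v) ^+ 2) - s ^+ 2).
    by rewrite hs /a1 /a2 /e; ring.
  by rewrite hx hy' /de /q; ring.
have bE : b1 ^+ 2 + b2 ^+ 2 + e ^+ 2 = de + q * u ^+ 2.
  transitivity ((y1 ^+ 2 + y2 ^+ 2 + v ^+ 2) * (x1 ^+ 2 + x2 ^+ 2 + (d * u) ^+ 2) - s ^+ 2).
    by rewrite hs /b1 /b2 /e; ring.
  by rewrite hy hx' /de /q; ring.
have nE : a1 * b1 + a2 * b2 + d * e ^+ 2 = d * de + s * q * (u * v).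
  transitivity (d * (x1 ^+ 2 + x2 ^+ 2 + u ^+ 2) * (y1 ^+ 2 + y2 ^+ 2 + v ^+ 2)
     - d * s ^+ 2 + s * q * (u * v)); last by rewrite hx hy /de; ring.
  by rewrite hs /a1 /a2 /b1 /b2 /e /q; ring.
have a0 : 0 < de + q * v ^+ 2 by rewrite addr_gt0 // mulr_gt0 // exprn_gt0.
have b0 : 0 < de + q * u ^+ 2 by rewrite addr_gt0 // mulr_gt0 // exprn_gt0.
rewrite aE bE nE; split => //.
rewrite -sqrtrM ?ltW//.
have n0 : 0 < d * de + s * q * (u * v) by rewrite addr_gt0 ?mulr_gt0 //; lra.
set n := d * de + _ in n0 *.
set p := (de + _) * _.
have -> : s * Num.sqrt p = Num.sqrt (s ^+ 2 * p).
  by rewrite [in RHS]sqrtrM ?sqr_ge0// sqrtr_sqr gtr0_norm.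
have -> : n = Num.sqrt (n ^+ 2) by rewrite sqrtr_sqr gtr0_norm.
(* After squaring, the difference of the two sides has the positive factor [de]; the other factor is
   bounded below through [2 * (d * u * v) - s * w]. *)
rewrite ltr_sqrt ?exprn_gt0// -subr_gt0.
pose w := u ^+ 2 + v ^+ 2.
have -> : n ^+ 2 - s ^+ 2 * p = de * ((q + de) * de + s * q * (2 * (d * u * v) - s * w)).
  rewrite /n /p (_ : (d * de + s * q * (u * v)) ^+ 2 =
    (1 + q) * de ^+ 2 + 2 * de * s * q * (d * u * v) + (s * q * (u * v)) ^+ 2);
    last by rewrite /q; ring.
  by rewrite /w /de; ring.
rewrite mulr_gt0 //.
(* The two squares give [2 * (x1 * y1 + x2 * y2) <= 2 - w], which bounds
   [d * u * v = s - (x1 * y1 + x2 * y2)] from below. *)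
have K : - (1 - s) * (2 - w) <= 2 * (d * u * v) - s * w.
  have := sqr_ge0 (x1 - y1); have := sqr_ge0 (x2 - y2).
  rewrite (_ : d * u * v = s - (x1 * y1 + x2 * y2)); last by rewrite hs; ring.
  rewrite /w; nra.
have w0 : 0 < w by rewrite addr_gt0 // exprn_gt0.
have sq0 : 0 < s * q by rewrite mulr_gt0.
apply: (@lt_le_trans _ _ ((q + de) * de + s * q * (- (1 - s) * (2 - w)))); last first.
  by rewrite lerD2l ler_wpM2l // ltW.
have -> : (q + de) * de + s * q * (- (1 - s) * (2 - w)) =
   (1 - s) * (q * (1 - s) + s * q * w + de * (1 + s)) by rewrite /de; ring.
have s1' : 0 < 1 - s by lra.
by rewrite mulr_gt0// addr_gt0 ?(mulr_gt0 de0) ?addr_gt0 ?(mulr_gt0 q0) ?(mulr_gt0 sq0) // addr_gt0.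

Qed.

(** The frames share [k] directions [W] orthogonal to [x], [y] and [nu]; there [P] is the identity,
    so they contribute [k >= s * k] to the trace. The remaining vectors are the normalized cross
    products of [x] with [P y] and of [P x] with [y], taken in the three-dimensional complement of
    [W], and [weighted_cross_product_bound] shows that they contribute more than [s]. *)
Lemma optimal_frames (R : realType) (k : nat) (x y nu : 'rV[R]_k.+3) (c s : R) :
  let P := 1%:M + c *: (nu^T *m nu) in
  dot x x = 1 -> dot y y = 1 -> dot nu nu = 1 -> 0 < c ->
  0 < dot x nu -> 0 < dot y nu -> s = dot x (y *m P) -> 0 < s < 1 ->
  exists E F : 'M[R]_(k.+1, k.+3),
  [/\ E *m E^T = 1%:M, F *m F^T = 1%:M,
    E *m x^T = 0 /\ E *m (y *m P)^T = 0,
    F *m y^T = 0 /\ F *m (x *m P)^T = 0 &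
    s * k.+1%:R < \tr (E *m P *m F^T)].
Proof.
move=> P xx yy nn c0 u0 v0 sE s01.
have PE z : z *m P = z + (c * dot z nu) *: nu.
  by rewrite mulmxDr mulmx1 -scalemxAr mulmxA mul_rV_tr mul_scalar_mx scalerA.
(* The dimension count [3 + k] is valid even when [x], [y] and [nu] are linearly dependent. *)
have [W [WW]] : exists W : 'M[R]_(k, k.+3), W *m W^T = 1%:M /\ col_mx x (col_mx y nu) *m W^T = 0.
  by apply: orthonormal_extension; rewrite !add1n.
move=> /mul_col_mx_eq0[xW /mul_col_mx_eq0[yW nW]].
have [f1 [f11 ]] : exists W' : 'rV[R]_k.+3, W' *m W'^T = 1%:M /\ col_mx nu W *m W'^T = 0.
  by apply: orthonormal_extension; rewrite addn1 add1n.
move=> /mul_col_mx_eq0[nf1 Wf1].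
have [f2 [f22 ]] : exists W' : 'rV[R]_k.+3,
    W' *m W'^T = 1%:M /\ col_mx f1 (col_mx nu W) *m W'^T = 0.
  by apply: orthonormal_extension; rewrite addn1 !add1n.
move=> /mul_col_mx_eq0[f1f2 /mul_col_mx_eq0[nf2 Wf2]].
have dot0 (a b : 'rV[R]_k.+3) : a *m b^T = 0 -> dot a b = 0 by rewrite dotE => ->; rewrite mxE.
have dot1 (a : 'rV[R]_k.+3) : a *m a^T = 1%:M -> dot a a = 1 by rewrite dotE => ->; rewrite mxE.
have Wz (z : 'rV[R]_k.+3) : z *m W^T = 0 -> W *m z^T = 0.
  by move=> h; rewrite -[LHS]trmxK trmx_mul trmxK h trmx0.
pose O : 'M[R]_k.+3 := col_mx f2 (col_mx f1 (col_mx nu W)).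
have O1 : O *m O^T = 1%:M.
  apply: col_mx_orthonormal; first exact: dot1.
    apply: col_mx_orthonormal; first exact: dot1.
      by apply: col_mx_orthonormal => //; exact: Wz.
    exact: (col_mx_mul_eq0 nf1 Wf1).
  exact: (col_mx_mul_eq0 f1f2 (col_mx_mul_eq0 nf2 Wf2)).
(* The rows of [O] form an orthonormal basis of the whole space, so a vector orthogonal to [W] keeps
   only its coordinates along [f1], [f2] and [nu]. *)
have expand z : z *m W^T = 0 -> z = dot z f1 *: f1 + dot z f2 *: f2 + dot z nu *: nu.
  move=> zW; have /(congr1 (mulmx z)) := mulmx1C O1.
  rewrite mulmx1 mulmxA (mul_tr_col_mx z f2) (mul_tr_col_mx z f1) (mul_tr_col_mx z nu).
  by rewrite zW mul0mx addr0 addrA [dot z f2 *: _ + _]addrC => h; rewrite -[LHS]h.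
pose vec a b g := a *: f1 + b *: f2 + g *: nu.
have f12 := dot0 _ _ f1f2; have nf1' := dot0 _ _ nf1; have nf2' := dot0 _ _ nf2.
have dvec a b g a' b' g' : dot (vec a b g) (vec a' b' g') = a * a' + b * b' + g * g'.
  rewrite /vec !(dotDl, dotDr, dotZl, dotZr) (dot1 _ f11) (dot1 _ f22) nn.
  by rewrite (dotC f2 f1) (dotC f1 nu) (dotC f2 nu) f12 nf1' nf2'; ring.
have vecW a b g : W *m (vec a b g)^T = 0.
  by rewrite /vec !linearD !linearZ /= -?scalemxAr Wf1 Wf2 (Wz _ nW) !scaler0 !addr0.
have Pvec a b g : vec a b g *m P = vec a b ((1 + c) * g).
  rewrite PE (_ : dot (vec a b g) nu = g).
    by rewrite /vec -addrA -scalerDl; congr (_ + _ *: _); ring.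
  have -> : nu = vec 0 0 1 by rewrite /vec !scale0r scale1r !add0r.
  by rewrite dvec; ring.
have PW : W *m P = W.
  by rewrite mulmxDr mulmx1 -scalemxAr mulmxA (Wz _ nW) mul0mx scaler0 addr0.
move: (expand x xW) (expand y yW); rewrite -/(vec _ _ _) -/(vec _ _ _).
set x1 := dot x f1; set x2 := dot x f2; set u := dot x nu in u0 *.
set y1 := dot y f1; set y2 := dot y f2; set v := dot y nu in v0 *.
move=> xE yE.
have hx : x1 ^+ 2 + x2 ^+ 2 + u ^+ 2 = 1 by rewrite -xx xE dvec; ring.
have hy : y1 ^+ 2 + y2 ^+ 2 + v ^+ 2 = 1 by rewrite -yy yE dvec; ring.
have hs : s = x1 * y1 + x2 * y2 + (1 + c) * u * v.
  by rewrite sE {1}xE {1}yE Pvec dvec; ring.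
have d1 : 1 < 1 + c by rewrite ltrDl.
have := weighted_cross_product_bound d1 u0 v0 s01 hx hy hs; rewrite /=.
set a1 := x2 * _ - _; set a2 := u * y1 - _; set b1 := x2 * v - _; set b2 := _ * y1 - x1 * v.
set e := x1 * y2 - _; set p := a1 ^+ 2 + _ + _; set q := b1 ^+ 2 + _ + _.
move=> [p0 q0 ab].
pose a := (Num.sqrt p)^-1 *: vec a1 a2 e.
pose b := (Num.sqrt q)^-1 *: vec b1 b2 e.
have unit_vec r z : 0 < r -> dot z z = r -> dot ((Num.sqrt r)^-1 *: z) ((Num.sqrt r)^-1 *: z) = 1.
  by move=> r0 zr; rewrite dotZl dotZr zr mulrA -expr2 exprVn sqr_sqrtr ?ltW// mulVf// gt_eqF.
have orth0 r z z' : dot z z' = 0 -> W *m z'^T = 0 -> col_mx (r *: z) W *m z'^T = 0.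
  move=> zz' Wz'; apply: (col_mx_mul_eq0 _ Wz').
  by rewrite -scalemxAl mul_rV_tr zz' raddf0 scaler0.
exists (col_mx a W), (col_mx b W); split.
- apply: col_mx_orthonormal => //; first by apply: unit_vec => //; rewrite dvec /p; ring.
  by rewrite linearZ -scalemxAr vecW scaler0.
- apply: col_mx_orthonormal => //; first by apply: unit_vec => //; rewrite dvec /q; ring.
  by rewrite linearZ -scalemxAr vecW scaler0.
- split; apply: orth0.
  + by rewrite xE dvec /a1 /a2 /e; ring.
  + by rewrite xE.
  + by rewrite yE Pvec dvec /a1 /a2 /e; ring.
  + by rewrite yE Pvec.
- split; apply: orth0.
  + by rewrite yE dvec /b1 /b2 /e; ring.
  + by rewrite yE.
  + by rewrite xE Pvec dvec /b1 /b2 /e; ring.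
  + by rewrite xE Pvec.
rewrite (mxtrace_mul_col_mx a b W W P) PW WW mxtrace1 -scalemxAl Pvec dotZl dotZr dvec.
rewrite -add1n natrD mulrDr mulr1; apply: ltr_leD; last first.
  by case/andP: s01 => _ s1; rewrite ler_piMl // ltW.
have sp : 0 < Num.sqrt p by rewrite sqrtr_gt0.
have sq : 0 < Num.sqrt q by rewrite sqrtr_gt0.
rewrite mulrA -invfM mulrC ltr_pdivlMr ?mulr_gt0 //.
by apply: (lt_le_trans ab); rewrite le_eqVlt; apply/orP; left; apply/eqP; ring.
Qed.

Lemma orthogonal_pair_row_free (R : realType) (n : nat) (x w : 'rV[R]_n) :
  x != 0 -> w != 0 -> dot x w = 0 -> row_free (col_mx x w).
Proof.
move=> x0 w0 xw; apply: inj_row_free => v.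
rewrite -(hsubmxK v) (mul_row_col (lsubmx v) (rsubmx v)).
rewrite [lsubmx v]mx11_scalar [rsubmx v]mx11_scalar !mul_scalar_mx.
set a := lsubmx v _ _; set b := rsubmx v _ _ => ab0.
have : dot (a *: x + b *: w) x = 0 by rewrite ab0 dotE mul0mx mxE.
have : dot (a *: x + b *: w) w = 0 by rewrite ab0 dotE mul0mx mxE.
rewrite !dotDl !dotZl xw (dotC w x) xw !mulr0 add0r addr0.
move=> /eqP; rewrite mulf_eq0 dot_eq0 (negbTE w0) orbF => /eqP ->.
move=> /eqP; rewrite mulf_eq0 dot_eq0 (negbTE x0) orbF => /eqP ->.
by rewrite !raddf0 row_mx0.
Qed.

(** The orthogonal complement of [x] and [w] has dimension [m], so the [m] independent rows of [J]
    span it. With [J] the Jacobian of a chart, this realizes a prescribed frame by directions in the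
    parameter space. *)
Lemma submx_orthogonal_frame (R : realType) (m : nat) (J E : 'M[R]_(m, m.+2))
    (x w : 'rV[R]_m.+2) :
  row_free J -> x != 0 -> w != 0 -> dot x w = 0 ->
  J *m x^T = 0 -> J *m w^T = 0 -> E *m x^T = 0 -> E *m w^T = 0 ->
  exists B : 'M[R]_m, E = B *m J.
Proof.
move=> fJ x0 w0 xw Jx Jw Ex Ew.
pose C := (col_mx x w)^T.
have CE (D : 'M[R]_(m, m.+2)) : D *m x^T = 0 -> D *m w^T = 0 -> (D <= kermx C)%MS.
  by move=> Dx Dw; apply/sub_kermxP; rewrite /C tr_col_mx mul_mx_row Dx Dw row_mx0.
have rC : \rank (kermx C) = m.
  rewrite mxrank_ker mxrank_tr (eqP (orthogonal_pair_row_free x0 w0 xw)).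
  by rewrite !addn1 -[in LHS]addn2 addnK.
have JC : (kermx C <= J)%MS.
  rewrite -(geq_leqif (mxrank_leqif_sup (CE J Jx Jw))) rC.
  by rewrite (eqP fJ).
by have /submxP[B ->] := submx_trans (CE E Ex Ew) JC; exists B.
Qed.

(** The rows of [E] together with [x] and the normalized [w] form an orthonormal basis, in which [n]
    has only a [w] coordinate. *)
Lemma normal_line (R : realType) (m : nat) (E : 'M[R]_(m, m.+2)) (x w n : 'rV[R]_m.+2) :
  E *m E^T = 1%:M -> dot x x = 1 -> w != 0 -> dot x w = 0 -> dot n x = 0 ->
  E *m x^T = 0 -> E *m w^T = 0 -> E *m n^T = 0 ->
  n = (dot n w / dot w w) *: w.
Proof.
move=> EE xx w0 xw nx Ex Ew En.
pose t := (Num.sqrt (dot w w))^-1.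
have ww := dot_gt0 w0.
have tt : t ^+ 2 = (dot w w)^-1 by rewrite exprVn sqr_sqrtr ?ltW.
pose O : 'M[R]_m.+2 := col_mx x (col_mx (t *: w) E).
have O1 : O *m O^T = 1%:M.
  apply: col_mx_orthonormal => //.
    apply: col_mx_orthonormal => //.
      by rewrite dotZl dotZr mulrA -expr2 tt mulVf // gt_eqF.
    by rewrite linearZ -scalemxAr Ew scaler0.
  have twx : (t *: w) *m x^T = 0 by rewrite -scalemxAl mul_rV_tr dotC xw raddf0 scaler0.
  exact: (col_mx_mul_eq0 twx Ex).
have /(congr1 (mulmx n)) := mulmx1C O1.
rewrite mulmx1 mulmxA (mul_tr_col_mx n x) (mul_tr_col_mx n (t *: w)) nx scale0r add0r.
have -> : n *m E^T = 0 by rewrite -[LHS]trmxK trmx_mul trmxK En trmx0.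
rewrite mul0mx addr0 dotZr scalerA => h; rewrite -[LHS]h; congr (_ *: _).
by rewrite -tt; ring.
Qed.

(** * Charts and normal fields *)

Lemma is_derive_coord (R : realType) (V : normedModType R) (m n : nat) (f : V -> 'M[R]_(m, n))
    (df : 'M[R]_(m, n)) (x v : V) (i : 'I_m) (j : 'I_n) :
  is_derive x v f df -> is_derive x v (fun z => f z i j) (df i j).
Proof.
move=> [fx <-]; apply: DeriveDef; first exact: (derivable_mxP f x v).1 fx i j.
by rewrite derive_mx // mxE.
Qed.

Lemma is_derive_dot (R : realType) (V : normedModType R) (n : nat) (f g : V -> 'rV[R]_n)
    (df dg : 'rV[R]_n) (x v : V) :
  is_derive x v f df -> is_derive x v g dg ->
  is_derive x v (fun z => dot (f z) (g z)) (dot df (g x) + dot (f x) dg).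
Proof.
move=> fx gx.
have -> : (fun z => dot (f z) (g z)) =
    \sum_(i < n) ((fun z => f z 0 i) * (fun z => g z 0 i)).
  by apply/funext => z; rewrite fct_sumE.
apply: is_derive_eq.
  apply: is_derive_sum => i.
  by apply: is_deriveM; [exact: is_derive_coord fx|exact: is_derive_coord gx].
rewrite addrC /dot -big_split /=; apply: eq_bigr => i _.
by rewrite /GRing.scale /= [_ * df _ _]mulrC.
Qed.

(* A parametrization phi together with a smooth map g on an open set of the ambient space
   that inverts phi on M. *)
Definition smooth_chart (R : realType) (m n : nat) (M : set 'rV[R]_n) (t0 : 'rV[R]_m)
    (V : set 'rV[R]_m) (phi : 'rV[R]_m -> 'rV[R]_n) (W : set 'rV[R]_n)
    (g : 'rV[R]_n -> 'rV[R]_m) : Prop :=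
  [/\ [/\ open V, V t0 & smooth_on V phi],
      [/\ open W, W (phi t0) & smooth_on W g],
      (forall t, V t -> M (phi t)) /\ row_free (jacobian phi t0),
      (forall q, M q -> W q -> V (g q) /\ phi (g q) = q) &
      g (phi t0) = t0 /\ exists C : R, forall q q', M q -> W q -> M q' -> W q' ->
        `|g q - g q'| <= C * `|q - q'|].

(** The Jacobian of [phi] at [t0] has a right inverse [K]. Following [phi] by the linear map [L] of
    matrix [K] gives a map with identity Jacobian at [t0], hence a local inverse [g0]; then
    [g0 \o L] is defined on an open set of the ambient space and inverts [phi] on [M]. *)
Lemma smooth_chart_exists (R : realType) (m n : nat) (M : set 'rV[R]_n) (p : 'rV[R]_n) :
  @embedded_submanifold R m n M -> M p ->
  exists t0 V phi W g, phi t0 = p /\ @smooth_chart R m n M t0 V phi W g.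
Proof.
move=> Msub Mp; have [V [phi [U [Up [[oV oU] sphi dphi phiV [psi [psiK cpsi]]]]]]] := Msub p Mp.
have : (M `&` U) p by [].
rewrite -phiV => -[t0 Vt0 phit0].
have df t : V t -> differentiable phi t by have /C_onS[d _] := sphi 1%N; exact: d.
pose J := jacobian phi t0.
have fJ : row_free J.
  apply: inj_row_free => v vJ; apply: (dphi t0 Vt0).
  by rewrite -(deriveE _ (df _ Vt0)) deriveEjacobian ?vJ ?linear0 //; exact: df.
have /row_freeP[K JK] := fJ.
pose L : {linear 'rV[R]_n -> 'rV[R]_m} := mulmxr K.
have cL : continuous L by exact: continuous_linear_rV.
have dL q : differentiable L q by exact: linear_differentiable.
have sL U' : smooth_on U' L by exact: smooth_linear.
pose f := L \o phi.
have sf : smooth_on V f.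
  by move=> r; apply: (C_on_comp_mx oV openT _ (sL setT r) (sphi r)).
have jf : jacobian f t0 = 1%:M.
  rewrite -JK; apply/matrixP => i j; rewrite mxE.
  rewrite (@diff_comp _ _ _ _ phi L)//; [|exact: df].
  rewrite /= diff_lin //.
  rewrite -(deriveE _ (df _ Vt0)) /= !mxE; apply: eq_bigr => l _.
  by rewrite (deriveEjacobian _ (df _ Vt0)) -rowE mxE.
have [r [g0 [r0 rV flip g0E sg0]]] := local_inverse oV Vt0 sf jf.
set Y := ball _ _ in g0E sg0.
have r40 : 0 < r / 4 by rewrite divr_gt0.
have oB : open (ball t0 r) by exact: ball_open.
have oY : open Y by exact: ball_open.
have MUp : (M `&` U) p by [].
(* Continuity of [psi] expresses embeddedness: points of [M] near [p] have parameters near [t0],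
   where [f] is injective. It excludes a second sheet of [M] passing through [W], on which [g0 \o L]
   would not invert [phi]. *)
have [] := (subspace_continuousP (M `&` U) psi).
move=> /(_ cpsi p MUp) /(_ (ball t0 r)) H _.
have psip : psi p = t0 by rewrite -phit0 psiK.
have {H} : nbhs p [set q | (M `&` U) q -> ball t0 r (psi q)].
  apply: H; rewrite psip; exact: nbhsx_ballx.
rewrite nbhsE => -[P [oP Pp] PH].
pose W := (P `&` U) `&` L @^-1` Y.
have oW : open W := @open_preimage_on R _ _ (P `&` U) Y L (openI oP oU) oY (fun x _ => cL x).
have Wg q : M q -> W q -> ball t0 r (g0 (L q)) /\ phi (g0 (L q)) = q.
  move=> Mq [[Pq Uq] Yq].
  have psiq : ball t0 r (psi q) by exact: (PH q Pq).
  have : (M `&` U) q by [].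
  rewrite -phiV => -[t Vt tq].
  have psit : psi q = t by rewrite -tq psiK.
  have [gr fg] := g0E _ Yq.
  suff -> : g0 (L q) = t by rewrite -psit; split=> //; rewrite psit.
  apply/eqP; rewrite -subr_eq0 -normr_le0.
  have := flip t (g0 (L q)) _ gr; rewrite fg /f /= tq subrr normr0 mulr0; apply.
  by rewrite -psit.
have Wp : W p.
  split; first by [].
  by rewrite /= -phit0; exact: ballxx.
exists t0, (ball t0 r), phi, W, (g0 \o L); split=> //; split.
- split => //; first exact: ballxx.
  by move=> i; apply: C_on_sub (sphi i).
- split => //; first by rewrite phit0.
  move=> i; apply: (C_on_comp_mx oW oY _ (sg0 i) (sL W i)).
  by move=> q [].
- split => // t /rV Vt.
  by have : (phi @` V) (phi t) by [exists t]; rewrite phiV => -[].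
- exact: Wg.
- split.
    have [gr gE] := Wg p Mp Wp.
    have [h1 h2] := g0E _ Wp.2.
    apply/eqP; rewrite -subr_eq0 -normr_le0 /= phit0.
    have := flip t0 (g0 (L p)) (ballxx _ r0) gr.
    by rewrite h2 /f /= phit0 subrr normr0 mulr0.
  have [k k0 Lk] := linear_lipschitz cL.
  exists (2 * k) => q q' Mq Wq Mq' Wq'.
  have [h1 h2] := g0E _ Wq.2; have [h1' h2'] := g0E _ Wq'.2.
  apply: (le_trans (flip _ _ h1' h1)); rewrite h2 h2' -mulrA ler_wpM2l // -linearB.
  exact: Lk.
Qed.

Lemma differentiable_smooth_on (R : realType) (V W : normedModType R) (U : set V) (f : V -> W) x :
  smooth_on U f -> U x -> differentiable f x.
Proof. by move=> sf Ux; have /C_onS[d _] := sf 1%N; exact: d. Qed.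

Lemma smooth_line (R : realType) (m : nat) (U : set R) (t a : 'rV[R]_m) : open U ->
  smooth_on U (fun h : R => t + h *: a).
Proof.
move=> oU r; apply: C_onD => //; first exact: C_on_cst.
apply: C_on_mx => // i j.
have : C_on r U (fun h : R => h * a i j).
  apply: C_onM => //; last exact: C_on_cst.
  case: r => [|r]; first by move=> x _; exact: cvg_id.
  apply/C_onS; split=> [x _|v]; first exact: ex_diff.
  rewrite (_ : 'D_v _ = fun=> v); first exact: C_on_cst.
  by apply/funext => x; exact: derive_id.
by apply: C_on_ext => // h _; rewrite mxE.
Qed.

Lemma segment_in_open (R : realType) (V : normedModType R) (U : set V) (t a : V) :
  open U -> U t -> exists2 e : R, 0 < e & forall h, `]-e, e[%classic h -> U (t + h *: a).
Proof.
move=> oU Ut.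
have : \forall h \near (0 : R), U (t + h *: a).
  have c : {for (0 : R), continuous (fun h : R => t + h *: a)}.
    apply: (near_lipschitz_continuous (K := `|a|)); exists 1 => //= h _.
    by rewrite scale0r addr0 addrC addKr subr0 normrZ mulrC.
  by apply: c; rewrite /= scale0r addr0; exact: open_nbhs_nbhs.
move=> /nbhs_ballP[e /= e0 eU]; exists e => // h; rewrite /= in_itv /= => /andP[h1 h2].
by apply: eU; rewrite -ball_normE /= sub0r normrN ltr_norml h1.
Qed.

Section Chart.
Context (R : realType) (m n : nat) (M : set 'rV[R]_n) (t0 : 'rV[R]_m)
  (V : set 'rV[R]_m) (phi : 'rV[R]_m -> 'rV[R]_n) (W : set 'rV[R]_n)
  (g : 'rV[R]_n -> 'rV[R]_m) (chart : smooth_chart M t0 V phi W g).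

Lemma chart_tangent_vector t a : V t -> tangent M (phi t) (a *m jacobian phi t).
Proof.
have [[oV Vt0 sphi] _ [Mphi _] _ _] := chart => Vt.
have [e e0 eV] := segment_in_open a oV Vt.
have oI : open `]-e, e[%classic by exact: itv_open.
have dphi := differentiable_smooth_on sphi Vt.
exists e, (fun h => phi (t + h *: a)); split => //.
- move=> r; apply: (C_on_comp_mx oI oV _ (sphi r) (smooth_line t a oI r)).
  exact: eV.
- by move=> h /eV; exact: Mphi.
- by rewrite scale0r addr0.
- have dphi0 : differentiable phi (t + 0 *: a) by rewrite scale0r addr0.
  have [_] := is_derive_line dphi0.
  by rewrite derive1E scale0r addr0 => ->; rewrite deriveEjacobian.
Qed.

(** Near time [0] a curve [c] in [M] equals [phi \o (g \o c)], and the smoothness of [g] on an open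
    set of the ambient space allows the chain rule. *)
Lemma tangent_chart_vector q v : M q -> W q -> tangent M q v ->
  exists a, v = a *m jacobian phi (g q).
Proof.
have [[oV Vt0 sphi] [oW _ sg] [Mphi _] gK _] := chart => Mq Wq.
move=> [e [c [e0 sc Mc c0 <-]]].
have I0 : `]-e, e[%classic (0 : R) by rewrite /= in_itv /= oppr_lt0 e0.
have dc := differentiable_smooth_on sc I0.
have [Vgq phigq] := gK q Mq Wq.
have dg : differentiable g (c 0) by rewrite c0; exact: differentiable_smooth_on sg Wq.
have dphi : differentiable phi ((g \o c) 0).
  by rewrite /= c0; exact: differentiable_smooth_on sphi Vgq.
have dgc : differentiable (g \o c) 0 by exact: differentiable_comp.
have cE : \forall h \near (0 : R), (phi \o (g \o c)) h = c h.
  have Ih : \forall h \near (0 : R), `]-e, e[%classic h.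
    by apply: open_nbhs_nbhs; split => //; exact: itv_open.
  have Wh : \forall h \near (0 : R), W (c h).
    by apply: (differentiable_continuous dc); rewrite c0; exact: open_nbhs_nbhs.
  by apply: filterS2 Ih Wh => h Ih Wh /=; have [] := gK (c h) (Mc _ Ih) Wh.
exists ('D_1 (g \o c) 0).
rewrite derive1E -(near_eq_derive (1 : R) cE) deriveE; last exact: differentiable_comp.
rewrite (@diff_comp _ _ _ _ (g \o c) phi)//= -(deriveE _ dgc) -(deriveE _ dphi).
by rewrite (deriveEjacobian _ dphi); congr (_ *m jacobian phi _); rewrite /= c0.
Qed.

End Chart.

(** Differentiate [dot (phi t) (phi t) = 1] in the direction [a]. *)
Lemma chart_orthogonal_sphere (R : realType) (m n : nat) (V : set 'rV[R]_m)
    (phi : 'rV[R]_m -> 'rV[R]_n) t a :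
  open V -> smooth_on V phi -> (forall t, V t -> dot (phi t) (phi t) = 1) -> V t ->
  dot (a *m jacobian phi t) (phi t) = 0.
Proof.
move=> oV sphi phi1 Vt.
have dphi := differentiable_smooth_on sphi Vt.
have D := DeriveDef (diff_derivable (v := a) dphi) erefl.
have [_] := is_derive_dot D D; rewrite deriveEjacobian // (dotC (phi t)).
rewrite (@near_eq_derive _ _ _ _ (cst (1 : R))); last first.
  have : \forall z \near t, V z by exact: open_nbhs_nbhs.
  by apply: filterS => z /phi1.
by rewrite derive_cst => /esym h; lra.
Qed.

Lemma jacobian_tr_mul (R : realType) (m n : nat) (J : 'M[R]_(m, n)) (z : 'rV[R]_n) :
  (forall a, dot (a *m J) z = 0) -> J *m z^T = 0.
Proof.
move=> h; apply/row_matrixP => i; rewrite row_mul row0.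
by rewrite mul_rV_tr rowE h raddf0.
Qed.

(* The rows of B t are phi t, a unit vector n0 normal to M at phi t0, and the derivatives of
   phi; the column of its inverse dual to the row n0 is orthogonal to all the other rows. *)
Lemma smooth_chart_normal (R : realType) (m : nat) (M : set 'rV[R]_m.+2) (t0 : 'rV[R]_m)
    (V : set 'rV[R]_m) (phi : 'rV[R]_m -> 'rV[R]_m.+2) (W : set 'rV[R]_m.+2)
    (g : 'rV[R]_m.+2 -> 'rV[R]_m) :
  smooth_chart M t0 V phi W g -> M `<=` @sphere R m.+1 ->
  exists U N, U (phi t0) /\ @unit_normal_on R m.+1 M U N.
Proof.
move=> chart MS.
have [[oV Vt0 sphi] [oW Wp sg] [Mphi fJ] gK [gp _]] := chart.
have phi1 t : V t -> dot (phi t) (phi t) = 1 by move=> /Mphi/MS.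
have Jphi : jacobian phi t0 *m (phi t0)^T = 0.
  by apply: jacobian_tr_mul => a; exact: chart_orthogonal_sphere phi1 Vt0.
have [n0 [n00 /mul_col_mx_eq0[phin0 Jn0]]] : exists n0 : 'rV[R]_m.+2,
    n0 *m n0^T = 1%:M /\ col_mx (phi t0) (jacobian phi t0) *m n0^T = 0.
  by apply: orthonormal_extension; rewrite addn1 add1n.
pose B t : 'M[R]_m.+2 := col_mx (phi t) (col_mx n0 (jacobian phi t)).
have CB r i j : C_on r V (fun t => B t i j).
  rewrite /B; have := (@C_on_ext R _ _ r V _ _ oV).
  case: (split_ordP (i : 'I_(1 + (1 + m)))) => i' ->.
    move=> H; apply: H (C_on_coord i' j oV (sphi r)) => t _.
    by rewrite (col_mxEu (phi t) (col_mx n0 (jacobian phi t))).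
  case: (split_ordP (i' : 'I_(1 + m))) => l ->.
    move=> H; apply: H (@C_on_cst R _ _ r V (n0 l j)) => t _.
    by rewrite (col_mxEd (phi t) (col_mx n0 (jacobian phi t))) (col_mxEu n0 (jacobian phi t)).
  move=> H; apply: H (C_on_jacobian l j oV (sphi r.+1)) => t _.
  by rewrite (col_mxEd (phi t) (col_mx n0 (jacobian phi t))) (col_mxEd n0 (jacobian phi t)).
have dB0 : \det (B t0) != 0.
  rewrite -unitfE -[_ \is a _]/(B t0 \in unitmx) -row_free_unit.
  apply: inj_row_free => v; rewrite -(hsubmxK (v : 'rV_(1 + (1 + m)))).
  set v1 := lsubmx _; set v2 := rsubmx _.
  rewrite /B (mul_row_col v1 v2) -(hsubmxK v2) (mul_row_col (lsubmx v2) (rsubmx v2)).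
  set a := lsubmx v2; set b := rsubmx v2; set J := jacobian phi t0 in fJ Jphi Jn0 *.
  move=> vB.
  have n0phi : n0 *m (phi t0)^T = 0 by rewrite -[LHS]trmxK trmx_mul trmxK phin0 trmx0.
  have v10 : v1 = 0.
    have := congr1 (mulmxr (phi t0)^T) vB; rewrite /= mul0mx !mulmxDl -!mulmxA.
    by rewrite n0phi Jphi !mulmx0 !addr0 mul_rV_tr phi1 // mulmx1.
  have a0 : a = 0.
    have := congr1 (mulmxr n0^T) vB; rewrite /= mul0mx !mulmxDl -!mulmxA.
    by rewrite phin0 Jn0 n00 !mulmx0 addr0 add0r mulmx1.
  have b0 : b = 0.
    apply: (row_free_inj fJ); rewrite mul0mx.
    by move: vB; rewrite v10 a0 !mul0mx !add0r.
  by rewrite v10 a0 b0 !row_mx0.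
pose Y := V `&` [set t | \det (B t) != 0].
have oY : open Y.
  have := @open_preimage_on R _ _ V [set x : R | x != 0] (fun t => \det (B t)) oV (@open_neq R 0).
  by apply => t Vt; exact: (C_on_continuous (C_on_det oV (CB 0%N)) Vt).
(* Row 0 of [B t] is [phi t], and row 1 is [n0]. *)
pose e1 : 'I_m.+2 := inord 1.
pose nt t : 'rV[R]_m.+2 := \row_j invmx (B t) j e1.
have YV : Y `<=` V by move=> t [].
have Cnt r : C_on r Y nt.
  apply: C_on_mx => // i j.
  apply: (C_on_ext (f := fun t => invmx (B t) j e1)) => //; first by move=> t _; rewrite mxE.
  apply: C_on_invmx => // [t [_ /=]|a b]; first by rewrite unitmxE unitfE.
  by apply: C_on_sub (CB r a b).
have ntB t : Y t -> B t *m (nt t)^T = delta_mx e1 0.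
  move=> [_ Bt]; have uB : B t \in unitmx by rewrite unitmxE unitfE.
  have -> : (nt t)^T = invmx (B t) *m delta_mx e1 0.
    by rewrite -colE; apply/colP => j; rewrite !mxE.
  by rewrite mulmxA mulmxV // mul1mx.
have ntphi t : Y t -> dot (nt t) (phi t) = 0 /\ jacobian phi t *m (nt t)^T = 0 /\ nt t != 0.
  move=> Yt; have := ntB t Yt; rewrite /B (mul_col_mx (phi t)) (mul_col_mx n0).
  move=> h.
  have h1 : phi t *m (nt t)^T = 0.
    have := congr1 (@usubmx R 1 (1 + m) 1) h; rewrite col_mxKu => ->.
    by apply/matrixP => i j; rewrite !mxE -val_eqE /= inordK // !ord1.
  split.
    by rewrite dotC dotE h1 mxE.
  split.
    have := congr1 (@dsubmx R 1 m 1 \o @dsubmx R 1 (1 + m) 1) h; rewrite /= !col_mxKd => ->.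
    by apply/matrixP => i j; rewrite !mxE -val_eqE /= inordK.
  apply/eqP => n_0; have := congr1 (fun A : 'cV_m.+2 => A e1 0) (ntB t Yt).
  by rewrite n_0 trmx0 mulmx0 !mxE !eqxx => /eqP; rewrite eq_sym oner_eq0.
(* Composing with [g] turns a field that depends on the parameter into one defined on an open set of
   the ambient space. *)
pose N q := (Num.sqrt (dot (nt (g q)) (nt (g q))))^-1 *: nt (g q).
have cg q : W q -> {for q, continuous g} by move=> Wq; exact: (C_on_continuous (sg 0%N) Wq).
have oU : open (W `&` g @^-1` Y) := @open_preimage_on R _ _ W Y g oW oY cg.
exists (W `&` g @^-1` Y), N; split.
  have Ygp : Y (g (phi t0)) by rewrite gp; exact: (conj Vt0 dB0).
  exact: (conj Wp Ygp).
split => //.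
  move=> r; rewrite /N.
  have Cng : C_on r (W `&` g @^-1` Y) (nt \o g).
    apply: (C_on_comp_mx oU oY _ (Cnt r)); first by move=> q [].
    by apply: C_on_sub (sg r) => q [].
  have Cng' j : C_on r (W `&` g @^-1` Y) (fun q => nt (g q) 0 j) by exact: C_on_coord Cng.
  have Cdot : C_on r (W `&` g @^-1` Y) (fun q => dot (nt (g q)) (nt (g q))).
    by apply: C_on_sum => // i _; exact: C_onM.
  have pdot q : (W `&` g @^-1` Y) q -> 0 < dot (nt (g q)) (nt (g q)).
    by move=> [_ Yq]; apply: dot_gt0; have [_ []] := ntphi _ Yq.
  apply: C_on_mx => // i j; rewrite ord1.
  apply: (C_on_ext (f := fun q => (Num.sqrt (dot (nt (g q)) (nt (g q))))^-1 * nt (g q) 0 j)) => //.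
    by move=> q _; rewrite [in RHS]mxE.
  apply: C_onM => //; apply: C_onV => //; last exact: C_on_sqrt.
  by move=> q /pdot h; rewrite gt_eqF // sqrtr_gt0.
move=> q Mq [Wq Yq]; have [h1 [h2 h3]] := ntphi _ Yq.
have [Vgq phigq] := gK q Mq Wq.
split.
- rewrite /N dotZl dotZr mulrA -expr2 exprVn sqr_sqrtr ?dot_ge0 // mulVf //.
  by rewrite dot_eq0.
- by rewrite /N dotZl; move: h1; rewrite phigq => ->; rewrite mulr0.
- move=> v /(tangent_chart_vector chart Mq Wq)[a ->].
  rewrite /N dotZl (_ : dot (nt (g q)) (a *m _) = 0) ?mulr0 //.
  by rewrite dotC dotE -mulmxA h2 mulmx0 mxE.
Qed.

(** * The second variation *)

Lemma row_dot (R : realType) (m n : nat) (A B : 'M[R]_(m, n)) (i j : 'I_m) :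
  dot (row i A) (row j B) = (A *m B^T) i j.
Proof. by rewrite mxE; apply: eq_bigr => l _; rewrite !mxE. Qed.

Lemma near_cst_derive0 (R : realType) (f : R -> R) (a x df : R) :
  is_derive x 1 f df -> (\forall y \near x, f y = a) -> df = 0.
Proof.
move=> [_ <-] fa; rewrite (@near_eq_derive _ _ _ f (cst a)) //; exact: derive_cst.
Qed.

(** The curves are images under a chart of straight lines. Each acceleration pairs with [p] to [-1],
    because the curve lies on the sphere, and with a unit normal to minus a diagonal entry of the
    second fundamental form, whose trace vanishes by minimality. Since [z] is a combination of [p]
    and the normal, only its [p] component survives in the sum. *)
Lemma minimal_second_variation (R : realType) (m : nat) (M : set 'rV[R]_m.+3)
    (p z : 'rV[R]_m.+3) (E : 'M[R]_(m.+1, m.+3)) :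
  @embedded_hypersurface R m.+2 M -> @minimal R m.+2 M -> M p ->
  (forall v, tangent M p v -> dot v z = 0) -> z - dot z p *: p != 0 ->
  E *m E^T = 1%:M -> E *m p^T = 0 -> E *m z^T = 0 ->
  exists (e : 'I_m.+1 -> R) (c c1 : 'I_m.+1 -> R -> 'rV[R]_m.+3) (c2 : 'I_m.+1 -> 'rV[R]_m.+3),
    (forall i, [/\ 0 < e i /\
        forall h, - e i < h < e i -> M (c i h) /\ is_derive h 1 (c i) (c1 i h),
      c i 0 = p, c1 i 0 = row i E &
      is_derive (0:R) 1 (c1 i) (c2 i)]) /\
    \sum_i dot (c2 i) z = - m.+1%:R * dot p z.
Proof.
move=> [MS Msub] Mmin Mp Tz w0 EE Ep Ez.
have [t0 [V [phi [W [g [phit0 chart]]]]]] := @smooth_chart_exists R m.+1 m.+3 M p Msub Mp.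
have [U [N [Up Nunit]]] := @smooth_chart_normal R m.+1 M t0 V phi W g chart MS.
have [[oV Vt0 sphi] [oW Wp sg] [Mphi fJ] gK [gp _]] := chart.
rewrite phit0 in Up.
have pp : dot p p = 1 by exact: MS.
have phi1 t : V t -> dot (phi t) (phi t) = 1 by move=> /Mphi/MS.
set w := z - dot z p *: p in w0.
have pw : dot p w = 0 by rewrite /w dotBr dotZr pp mulr1 (dotC z) subrr.
pose J := jacobian phi t0.
have TJ a : tangent M p (a *m J) by have := chart_tangent_vector chart a Vt0; rewrite phit0.
have Jp : J *m p^T = 0.
  by apply: jacobian_tr_mul => a; rewrite -phit0; exact: chart_orthogonal_sphere phi1 Vt0.
have Jz : J *m z^T = 0 by apply: jacobian_tr_mul => a; apply: Tz.
have mulw (k : nat) (A : 'M[R]_(k, m.+3)) : A *m p^T = 0 -> A *m z^T = 0 -> A *m w^T = 0.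
  by move=> Ap Az; rewrite /w linearB linearZ /= mulmxBr -scalemxAr Ap Az scaler0 subr0.
have p0 : p != 0 by rewrite -dot_eq0 pp oner_eq0.
have [B EB] := submx_orthogonal_frame fJ p0 w0 pw Jp (mulw _ _ Jp Jz) Ep (mulw _ _ Ep Ez).
pose a i := row i B.
have aJ i : a i *m J = row i E by rewrite EB row_mul.
have He i : exists2 e : R, 0 < e & forall h, `]-e, e[%classic h -> V (t0 + h *: a i).
  exact: segment_in_open.
pose e i := projT1 (cid2 (He i)).
have e0 i : 0 < e i by rewrite /e; case: (cid2 _).
have eV i h : - e i < h < e i -> V (t0 + h *: a i).
  move=> hh; rewrite /e in hh *; move: hh.
  by case: (cid2 _) => /= x _ H hh; apply: H; rewrite /= in_itv.
pose c i (h : R) := phi (t0 + h *: a i).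
pose c1 i (h : R) := 'D_(a i) phi (t0 + h *: a i).
pose c2 i := 'D_(a i) ('D_(a i) phi) t0.
have V0 i : V (t0 + (0 : R) *: a i) by rewrite scale0r addr0.
have dphi t : V t -> differentiable phi t by exact: differentiable_smooth_on.
have dc i h : - e i < h < e i -> is_derive h 1 (c i) (c1 i h).
  by move=> /eV Vh; apply: is_derive_line; exact: dphi.
have I0 i : - e i < 0 < e i by rewrite oppr_lt0 e0.
have dc1 i : is_derive (0:R) 1 (c1 i) (c2 i).
  have [_ D1phi] := (C_onS _ _ _).1 (sphi 2%N).
  have dD : differentiable ('D_(a i) phi) (t0 + 0 *: a i).
    by have [d _] := (C_onS _ _ _).1 (D1phi (a i)); exact: d.
  have -> : c2 i = 'D_(a i) ('D_(a i) phi) (t0 + (0 : R) *: a i).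
    by rewrite scale0r addr0.
  exact: is_derive_line dD.
have c0 i : c i 0 = p by rewrite /c scale0r addr0.
have c10 i : c1 i 0 = row i E.
  by rewrite /c1 scale0r addr0 deriveEjacobian; [exact: aJ|exact: dphi].
have c1E i h : - e i < h < e i -> c1 i h = a i *m jacobian phi (t0 + h *: a i).
  by move=> /eV Vh; exact: (deriveEjacobian _ (dphi _ Vh)).
have nearI i : \forall h \near (0 : R), - e i < h < e i.
  have := near_in_itvoo (_ : (0 : R) \in `]- e i, e i[).
  by rewrite in_itv /= I0 => /(_ isT); apply: filterS => h; rewrite in_itv.
(* Derivative at [0] of [dot (c1 i h) (c i h) = 0]. *)
have c2p i : dot (c2 i) p = - 1.
  have := near_cst_derive0 (a := 0) (is_derive_dot (dc1 i) (dc i 0 (I0 i))).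
  rewrite c0 c10 row_dot EE mxE eqxx => H.
  apply/eqP; rewrite -addr_eq0; apply/eqP; apply: H.
  apply: filterS (nearI i) => h hh; rewrite c1E //.
  by apply: chart_orthogonal_sphere oV sphi phi1 _; exact: eV.
have [oU sN NU] := Nunit.
have [N1 Np NT] := NU p Mp Up.
have frame : @orthonormal_frame R m.+2 M p (fun i => row i E).
  by split=> [i|i j]; [rewrite -aJ; exact: TJ|rewrite row_dot EE mxE].
have mc : \sum_i dot ('D_(row i E) N p) (row i E) = 0.
  have := Mmin p U N _ Mp Up Nunit frame.
  by rewrite /mean_curvature => /eqP; rewrite mulf_eq0 invr_eq0 pnatr_eq0 /= => /eqP.
have dN : differentiable N p by exact: differentiable_smooth_on sN Up.
(* Derivative at [0] of [dot (N (c i h)) (c1 i h) = 0], which holds because the velocity is tangent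
   to [M]. *)
have c2N i : dot (N p) (c2 i) = - dot ('D_(row i E) N p) (row i E).
  have dci : differentiable (c i) 0.
    by apply/derivable1_diffP; have [] := dc i 0 (I0 i).
  have dNc : is_derive (0 : R) 1 (N \o c i) ('D_(row i E) N p).
    have dNci : differentiable N (c i 0) by rewrite c0.
    have dd : differentiable (N \o c i) 0 by exact: differentiable_comp.
    apply: DeriveDef; first exact: diff_derivable.
    rewrite (deriveE _ dd) (@diff_comp _ _ _ _ (c i) N) // -[LHS]/('d N (c i 0) ('d (c i) 0 1)).
    have -> : 'd (c i) 0 1 = row i E.
      by rewrite -(deriveE _ dci) -c10; have [_ ->] := dc i 0 (I0 i).
    by rewrite -(deriveE _ dNci) c0.
  have := near_cst_derive0 (a := 0) (is_derive_dot dNc (dc1 i)).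
  rewrite /= c0 c10 => H.
  apply/eqP; rewrite -addr_eq0 addrC; apply/eqP; apply: H.
  have nearU : \forall h \near (0 : R), U (c i h).
    have cc : {for (0 : R), continuous (c i)} by exact: differentiable_continuous.
    by apply: cc; rewrite c0; exact: open_nbhs_nbhs.
  apply: filterS2 (nearI i) nearU => h hh Uh.
  have Vh := eV i h hh.
  have [_ _] := NU (c i h) (Mphi _ Vh) Uh; apply.
  by rewrite c1E //; exact: (chart_tangent_vector chart (a i) Vh).
have EN : E *m (N p)^T = 0.
  apply/row_matrixP => i; rewrite row_mul row0 mul_rV_tr dotC NT ?raddf0 //.
  by rewrite -aJ; exact: TJ.
(* Both [N p] and [w] are normal to [M] inside the sphere, hence proportional. The factor is nonzero
   because [N p] is a unit vector, so the vanishing of the trace carries over to [w]. *)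
have Nw := normal_line EE pp w0 pw Np Ep (mulw _ _ Ep Ez) EN.
set l := _ / _ in Nw.
have l0 : l != 0.
  apply/eqP => l0; move: N1; rewrite Nw l0 scale0r dotE mul0mx mxE => /esym/eqP.
  by rewrite oner_eq0.
have c2w : \sum_i dot (c2 i) w = 0.
  apply: (mulfI l0); rewrite mulr0.
  transitivity (- \sum_i dot ('D_(row i E) N p) (row i E)); last by rewrite mc oppr0.
  rewrite mulr_sumr -sumrN.
  by apply: eq_bigr => i _; rewrite -c2N [in RHS]Nw dotZl (dotC w).
have Mc i h : - e i < h < e i -> M (c i h) by move=> hh; apply: Mphi; exact: eV.
have Mdc i : 0 < e i /\
    forall h, - e i < h < e i -> M (c i h) /\ is_derive h 1 (c i) (c1 i h).
  by split; [exact: e0|move=> h hh; split; [exact: Mc|exact: dc]].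
exists e, c, c1, c2; split; first by move=> i; exact: And4 (Mdc i) (c0 i) (c10 i) (dc1 i).
have -> : \sum_i dot (c2 i) z = \sum_i (dot (c2 i) w - dot z p).
  apply: eq_bigr => i _; rewrite /w dotBr dotZr c2p; ring.
by rewrite big_split /= c2w add0r sumr_const card_ord (dotC p) -mulr_natl; ring.
Qed.

(** * First- and second-order conditions at a maximum *)

Lemma second_derivative_at_max (R : realType) (f f1 : R -> R) (f2 e : R) : 0 < e ->
  (forall h, - e < h < e -> is_derive h 1 f (f1 h)) -> is_derive (0 : R) 1 f1 f2 ->
  (forall h, - e < h < e -> f h <= f 0) -> f1 0 = 0 /\ f2 <= 0.
Proof.
move=> e0 df df1 fmax.
have I0 : - e < 0 < e by rewrite oppr_lt0 e0.
have f10 : f1 0 = 0.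
  have ee : - e <= e by lra.
  have [_ H] := @derive1_at_max R f (- e) e 0 ee
    (fun h hh => ltac:(by have [] := df h ltac:(by move: hh; rewrite in_itv)))
    ltac:(by rewrite in_itv) (fun h hh => fmax h ltac:(by move: hh; rewrite in_itv)).
  by have [_ <-] := df 0 I0.
(* If [f2] were positive, [f1] would be positive just to the right of [0], and the mean value
   theorem would produce a value above [f 0]. *)
split => //; rewrite leNgt; apply/negP => f20.
have [_ f2E] := df1.
have [d d0 dP] : exists2 d, 0 < d & forall h, 0 < h < d -> 0 < f1 h.
  have [c _] := df1.
  have cv : h^-1 *: (f1 (h *: 1 + 0) - f1 0) @[h --> 0^'] --> f2.
    by rewrite -f2E; exact: c.
  have : \forall h \near 0^', 0 < h^-1 *: (f1 (h *: 1 + 0) - f1 0).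
    exact: (cvgr_gt _ cv).
  move=> /nbhs_ballP[d /= d0 dP]; exists d => // h /andP[h0 hd].
  have := dP h; rewrite /ball /= sub0r normrN gtr0_norm // hd => /(_ isT).
  rewrite gt_eqF // => /(_ isT); rewrite f10 subr0 addr0 [_ *: 1]mulr1.
  by rewrite /GRing.scale /= pmulr_rgt0 // invr_gt0.
pose h := Num.min d e / 2.
have m0 : 0 < Num.min d e by rewrite lt_min d0.
have md : Num.min d e <= d by rewrite ge_min lexx.
have me : Num.min d e <= e by rewrite ge_min lexx orbT.
have h0 : 0 < h by rewrite /h divr_gt0.
have hh : h < Num.min d e by rewrite /h; lra.
have [| |x] := @MVT R f f1 0 h h0.
- by move=> x; rewrite in_itv /= => /andP[x0 xh]; apply: df; apply/andP; split; lra.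
- apply: derivable_within_continuous => x; rewrite in_itv /= => /andP[x0 xh].
  by have [] := df x ltac:(apply/andP; split; lra).
rewrite in_itv /= => /andP[x0 xh] fE.
have f1x : 0 < f1 x by apply: dP; apply/andP; split; lra.
have := fmax h ltac:(apply/andP; split; lra).
have : 0 < f1 x * (h - 0) by rewrite mulr_gt0 // subr0.
lra.
Qed.

(** First-order condition along the curve that realizes [v], restricted to a time interval during
    which it stays in [O]. *)
Lemma tangent_at_max (R : realType) (n : nat) (M O : set 'rV[R]_n) (p z v : 'rV[R]_n) :
  open O -> O p -> (forall q, M q -> O q -> dot q z <= dot p z) ->
  tangent M p v -> dot v z = 0.
Proof.
move=> oO Op pmax [e [c [e0 sc Mc c0 <-]]].
have dc h : `]-e, e[%classic h -> differentiable c h by exact: differentiable_smooth_on.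
have I0 : `]-e, e[%classic (0 : R) by rewrite /= in_itv /= oppr_lt0 e0.
have nearO : \forall h \near (0 : R), O (c h).
  by apply: (differentiable_continuous (dc _ I0)); rewrite c0; exact: open_nbhs_nbhs.
move: nearO => /nbhs_ballP[d /= d0 dO].
pose r := Num.min d e.
have r0 : 0 < r by rewrite lt_min d0.
have rd : r <= d by rewrite ge_min lexx.
have re : r <= e by rewrite ge_min lexx orbT.
have Ie h : h \in `]- r, r[ -> `]-e, e[%classic h.
  by rewrite /= !in_itv /= => /andP[h1 h2]; apply/andP; split; lra.
pose f h := dot (c h) z.
have df h : `]-e, e[%classic h -> is_derive h 1 f (dot ('D_1 c h) z).
  move=> hh; have D := DeriveDef (diff_derivable (v := (1 : R)) (dc h hh)) erefl.
  have := is_derive_dot D (is_derive_cst z h (1 : R)).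
  by rewrite (_ : dot (c h) 0 = 0) ?addr0 // dotC dotE mul0mx mxE.
have rr : - r <= r by lra.
have [||| _ H] := @derive1_at_max R f (- r) r 0 rr.
- by move=> h /Ie hh; have [] := df h hh.
- by rewrite in_itv /= oppr_lt0 r0.
- move=> h hr; rewrite /f c0; apply: pmax; first by apply: Mc; exact: Ie.
  apply: dO; rewrite -ball_normE /= sub0r normrN.
  by move: hr; rewrite in_itv /= => /andP[h1 h2]; rewrite ltr_norml; apply/andP; split; lra.
by rewrite derive1E; have [_ <-] := df 0 I0.
Qed.

Lemma is_derive_mulmx (R : realType) (m n : nat) (f : R -> 'rV[R]_m) (df : 'rV[R]_m)
    (P : 'M[R]_(m, n)) (h : R) :
  is_derive h 1 f df -> is_derive h 1 (fun h => f h *m P) (df *m P).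
Proof.
move=> [fh <-].
pose L : {linear 'rV[R]_m -> 'rV[R]_n} := mulmxr P.
have cL : continuous L by exact: continuous_linear_rV.
have dL q : differentiable L q by exact: linear_differentiable.
have df' : differentiable f h by exact/derivable1_diffP.
have dd : differentiable (L \o f) h by exact: differentiable_comp.
have : is_derive h 1 (L \o f) (L ('D_1 f h)).
  apply: DeriveDef; first exact: diff_derivable.
  by rewrite (deriveE _ dd) (@diff_comp _ _ _ _ f L) //= diff_lin // (deriveE _ df').
by [].
Qed.

(** Varying one point alone gives the orthogonality conditions on the tangent spaces. Varying both
    points along the curves attached to the [i]-th rows of [E] and [F] gives the second-order
    condition [key], whose sum over [i] contradicts [optimal_frames]. *)
Lemma no_interior_maximum (R : realType) (m : nat) (M Ox Oy : set 'rV[R]_m.+3)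
    (x y nu : 'rV[R]_m.+3) (c s : R) :
  let P := 1%:M + c *: (nu^T *m nu) in
  @embedded_hypersurface R m.+2 M -> @minimal R m.+2 M ->
  open Ox -> open Oy -> M x -> M y -> Ox x -> Oy y ->
  dot nu nu = 1 -> 0 < c -> 0 < dot x nu -> 0 < dot y nu ->
  s = dot x (y *m P) -> 0 < s < 1 ->
  (forall x' y', M x' -> Ox x' -> M y' -> Oy y' -> dot x' (y' *m P) <= s) -> False.
Proof.
move=> P Mhyp Mmin oOx oOy Mx My Oxx Oyy nn c0 u0 v0 sE s01 smax.
have [MS _] := Mhyp.
have xx : dot x x = 1 by exact: MS.
have yy : dot y y = 1 by exact: MS.
have PT : P^T = P.
  by rewrite /P linearD linearZ /= trmx1 trmx_mul trmxK.
have Psym a b : dot a (b *m P) = dot b (a *m P).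
  by rewrite dotC !dotE trmx_mul PT mulmxA.
have PE z : z *m P = z + (c * dot z nu) *: nu.
  by rewrite mulmxDr mulmx1 -scalemxAr mulmxA mul_rV_tr mul_scalar_mx scalerA.
have Tx v : tangent M x v -> dot v (y *m P) = 0.
  by apply: (tangent_at_max oOx Oxx) => q Mq Oq; rewrite -sE; exact: smax.
have Ty v : tangent M y v -> dot v (x *m P) = 0.
  by apply: (tangent_at_max oOy Oyy) => q Mq Oq; rewrite !(Psym _ x) -sE; exact: smax.
have /andP[s0 s1] := s01.
(* Otherwise [b *m P] would equal [s *: a], of length [s < 1], whereas its squared length is
   [1 + (2 * c + c ^+ 2) * dot b nu ^+ 2]. *)
have w0 a b : dot a a = 1 -> dot b b = 1 -> dot (b *m P) a = s -> b *m P - dot (b *m P) a *: a != 0.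
  move=> aa bb bas; apply/eqP => /eqP; rewrite subr_eq0 bas => /eqP bP.
  have : dot (b *m P) (b *m P) = s ^+ 2 by rewrite bP dotZl dotZr aa; ring.
  rewrite PE !dotDl !dotDr !dotZl !dotZr bb (dotC nu b) nn => h.
  have h1 : 0 <= c * dot b nu ^+ 2 by rewrite mulr_ge0 ?sqr_ge0// ltW.
  have h2 : 0 <= c ^+ 2 * dot b nu ^+ 2 by rewrite mulr_ge0 ?sqr_ge0.
  have h3 : s ^+ 2 < 1 by rewrite expr_lt1 // ltW.
  have : s ^+ 2 = 1 + 2 * (c * dot b nu ^+ 2) + c ^+ 2 * dot b nu ^+ 2 by rewrite -h; ring.
  lra.
have wx : y *m P - dot (y *m P) x *: x != 0 by apply: w0 => //; rewrite dotC.
have wy : x *m P - dot (x *m P) y *: y != 0 by apply: w0 => //; rewrite dotC -Psym.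
have [E [F [EE FF [Ex Ey] [Fy Fx] tr]]] := optimal_frames xx yy nn c0 u0 v0 sE s01.
rewrite -/P in Ey Fx tr.
have [e [f [f1 [f2 [Hf Sf]]]]] := minimal_second_variation Mhyp Mmin Mx Tx wx EE Ex Ey.
have [e' [g [g1 [g2 [Hg Sg]]]]] := minimal_second_variation Mhyp Mmin My Ty wy FF Fy Fx.
have nearO (O : set 'rV[R]_m.+3) (k k1 : R -> 'rV[R]_m.+3) (r : R) : open O -> 0 < r ->
    (forall h, - r < h < r -> M (k h) /\ is_derive h 1 k (k1 h)) -> O (k 0) ->
    exists2 d, 0 < d & forall h, - d < h < d -> O (k h).
  move=> oO r0 Hk Ok.
  have [_ [dk _]] := Hk 0 ltac:(by rewrite oppr_lt0 r0).
  have : \forall h \near (0 : R), O (k h).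
    by apply: (differentiable_continuous ((derivable1_diffP _ _).1 dk)); exact: open_nbhs_nbhs.
  move=> /nbhs_ballP[d /= d0 dO]; exists d => // h hd.
  by apply: dO; rewrite -ball_normE /= sub0r normrN ltr_norml.
(* The left side is the second derivative at [0] of [dot (f i h) (g i h *m P)]: two acceleration
   terms and twice the mixed term. *)
have key i : dot (f2 i) (y *m P) + dot (row i E) (row i F *m P) +
    (dot (row i E) (row i F *m P) + dot x (g2 i *m P)) <= 0.
  have [[ei Hfi] f0 f10 f20] := Hf i; have [[e'i Hgi] g0 g10 g20] := Hg i.
  have [d d0 dO] := nearO Ox (f i) (f1 i) (e i) oOx ei Hfi ltac:(by rewrite f0).
  have [d' d'0 d'O] := nearO Oy (g i) (g1 i) (e' i) oOy e'i Hgi ltac:(by rewrite g0).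
  pose r := Num.min (Num.min d d') (Num.min (e i) (e' i)).
  have r0 : 0 < r by rewrite !lt_min d0 d'0 ei e'i.
  have rd : r <= d by rewrite !ge_min lexx.
  have rd' : r <= d' by rewrite !ge_min lexx !orbT.
  have re : r <= e i by rewrite !ge_min lexx !orbT.
  have re' : r <= e' i by rewrite !ge_min lexx !orbT.
  have sub (q h : R) : r <= q -> - r < h < r -> - q < h < q.
    move=> rq /andP[h1 h2]; rewrite (lt_le_trans h2 rq) andbT.
    by rewrite (le_lt_trans _ h1) // lerN2.
  pose G h := dot (f i h) (g i h *m P).
  pose G1 h := dot (f1 i h) (g i h *m P) + dot (f i h) (g1 i h *m P).
  have dG h : - r < h < r -> is_derive h 1 G (G1 h).
    move=> hr; have [_ df] := Hfi h (sub _ _ re hr); have [_ dg] := Hgi h (sub _ _ re' hr).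
    exact: is_derive_dot df (is_derive_mulmx P dg).
  have r00 : - r < 0 < r by rewrite oppr_lt0 r0.
  have [_ df0] := Hfi 0 (sub _ _ re r00); have [_ dg0] := Hgi 0 (sub _ _ re' r00).
  have dG1 := is_deriveD (is_derive_dot f20 (is_derive_mulmx P dg0))
    (is_derive_dot df0 (is_derive_mulmx P g20)).
  rewrite f0 g0 f10 g10 in dG1.
  have Gmax h : - r < h < r -> G h <= G 0.
    move=> hr; rewrite {2}/G f0 g0 -sE; apply: smax.
    - by have [] := Hfi h (sub _ _ re hr).
    - by apply: dO; exact: sub hr.
    - by have [] := Hgi h (sub _ _ re' hr).
    - by apply: d'O; exact: sub hr.
  by have [] := second_derivative_at_max r0 dG dG1 Gmax.
have : \sum_i (dot (f2 i) (y *m P) + dot (row i E) (row i F *m P) +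
    (dot (row i E) (row i F *m P) + dot x (g2 i *m P))) <= 0 by exact: sumr_le0.
(* By [minimal_second_variation] the accelerations on each side sum to [- m.+1%:R * s]; the mixed
   terms sum to the trace. *)
have -> : \sum_i (dot (f2 i) (y *m P) + dot (row i E) (row i F *m P) +
    (dot (row i E) (row i F *m P) + dot x (g2 i *m P))) =
    - m.+1%:R * s + \tr (E *m P *m F^T) + (\tr (E *m P *m F^T) + - m.+1%:R * s).
  have trE : \sum_i dot (row i E) (row i F *m P) = \tr (E *m P *m F^T).
    by apply: eq_bigr => i _; rewrite -row_mul row_dot trmx_mul PT mulmxA.
  rewrite !big_split /= trE Sf -sE; congr (_ + (_ + _)).
  under eq_bigr do rewrite Psym.
  by rewrite Sg -Psym -sE.
move=> h; lra.
Qed.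

(** * The two pieces *)

Lemma continuous_dotl (R : realType) (n : nat) (nu : 'rV[R]_n) :
  continuous (fun x : 'rV[R]_n => dot x nu).
Proof.
suff : C_on 0 setT (fun x : 'rV[R]_n => dot x nu) by move=> H x; exact: H.
apply: C_on_sum => [|i _]; first exact: openT.
apply: C_onM; [exact: openT| |exact: C_on_cst].
by move=> x _; exact: coord_continuous.
Qed.

Lemma continuous_dot (R : realType) (n : nat) :
  continuous (fun z : 'rV[R]_n * 'rV[R]_n => dot z.1 z.2).
Proof.
suff : C_on 0 setT (fun z : 'rV[R]_n * 'rV[R]_n => dot z.1 z.2) by move=> H x; exact: H.
apply: C_on_sum => [|i _]; first exact: openT.
apply: C_onM; first exact: openT.
- by apply: (@C_on_coord R _ 0 setT 1 n fst); [exact: openT|move=> x _; exact: cvg_fst].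
- by apply: (@C_on_coord R _ 0 setT 1 n snd); [exact: openT|move=> x _; exact: cvg_snd].
Qed.

Lemma continuous_dot_fst (R : realType) (n : nat) (nu : 'rV[R]_n) :
  continuous (fun z : 'rV[R]_n * 'rV[R]_n => dot z.1 nu).
Proof.
suff : C_on 0 setT (fun z : 'rV[R]_n * 'rV[R]_n => dot z.1 nu) by move=> H x; exact: H.
apply: C_on_sum => [|i _]; first exact: openT.
apply: C_onM; [exact: openT| |exact: C_on_cst].
by apply: (@C_on_coord R _ 0 setT 1 n fst); [exact: openT|move=> x _; exact: cvg_fst].
Qed.

Lemma continuous_dot_snd (R : realType) (n : nat) (nu : 'rV[R]_n) :
  continuous (fun z : 'rV[R]_n * 'rV[R]_n => dot z.2 nu).
Proof.
suff : C_on 0 setT (fun z : 'rV[R]_n * 'rV[R]_n => dot z.2 nu) by move=> H x; exact: H.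
apply: C_on_sum => [|i _]; first exact: openT.
apply: C_onM; [exact: openT| |exact: C_on_cst].
by apply: (@C_on_coord R _ 0 setT 1 n snd); [exact: openT|move=> x _; exact: cvg_snd].
Qed.

(** Links the sup norm of the chart estimates with the Euclidean norm that underlies
    [1 - dot x y]. *)
Lemma norm_sqr_le_dot (R : realType) (n : nat) (v : 'rV[R]_n) : `|v| ^+ 2 <= dot v v.
Proof.
have sq0 := sqrtr_ge0 (dot v v).
have : `|v| <= Num.sqrt (dot v v).
  rewrite [leLHS]/Num.Def.normr/= mx_normrE bigmax_le // => -[i j] _ /=.
  rewrite ord1 -(@ger0_norm _ (Num.sqrt _)) // -ler_sqr ?nnegrE // !real_normK ?num_real //.
  rewrite sqr_sqrtr ?dot_ge0 // /dot (bigD1 j) //= -expr2 lerDl.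
  by apply: sumr_ge0 => l _; rewrite -expr2 sqr_ge0.
by move=> h; rewrite -(sqr_sqrtr (dot_ge0 v)) ler_sqr ?nnegrE.
Qed.

Lemma dot_le1 (R : realType) (n : nat) (x y : 'rV[R]_n) :
  dot x x = 1 -> dot y y = 1 -> dot x y <= 1.
Proof.
move=> xx yy; have := dot_ge0 (x - y).
by rewrite !(dotBl, dotBr) xx yy (dotC y x); lra.
Qed.

Lemma dot_eq1 (R : realType) (n : nat) (x y : 'rV[R]_n) :
  dot x x = 1 -> dot y y = 1 -> 1 <= dot x y -> x = y.
Proof.
move=> xx yy xy; have := dot_ge0 (x - y).
rewrite !(dotBl, dotBr) xx yy (dotC y x) => h.
apply/eqP; rewrite -subr_eq0 -dot_eq0 !(dotBl, dotBr) xx yy (dotC y x).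
by apply/eqP; lra.
Qed.

Lemma segment_image_connected (R : realType) (m : nat) (T : topologicalType) (V : set 'rV[R]_m)
    (phi : 'rV[R]_m -> T) (t a : 'rV[R]_m) :
  (forall t, V t -> {for t, continuous phi}) ->
  (forall s : R, 0 <= s <= 1 -> V (t + s *: a)) ->
  connected ((fun s => phi (t + s *: a)) @` `[0, 1]%classic).
Proof.
move=> cphi inV; apply: connected_continuous_connected; first exact: segment_connected.
apply: continuous_in_subspaceT => s; rewrite inE /= in_itv /= => s01.
apply: (@continuous_comp _ _ _ (fun s : R => t + s *: a) phi); last exact/cphi/inV.
have := @smooth_line R m setT t a openT 0%N; apply => //.
Qed.

Section Pieces.
Context (R : realType) (m n : nat) (M A B : set 'rV[R]_n) (nu : 'rV[R]_n)
  (AB : separated A B) (MAB : A `|` B = M `&` [set q | 0 < dot q nu])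
  (t0 : 'rV[R]_m)
  (V : set 'rV[R]_m) (phi : 'rV[R]_m -> 'rV[R]_n) (W : set 'rV[R]_n)
  (g : 'rV[R]_n -> 'rV[R]_m) (chart : smooth_chart M t0 V phi W g).

(* A segment of parameters mapped into the positive side of M cannot pass from A to B. *)
Lemma segment_same_piece (t a : 'rV[R]_m) :
  (forall s : R, 0 <= s <= 1 -> V (t + s *: a) /\ 0 < dot (phi (t + s *: a)) nu) ->
  A (phi t) <-> A (phi (t + a)).
Proof.
have [[oV Vt0 sphi] _ [Mphi _] _ _] := chart => ta.
have cphi t' : V t' -> {for t', continuous phi}.
  by move=> /(differentiable_smooth_on sphi)/differentiable_continuous.
set S := (fun s => phi (t + s *: a)) @` `[0, 1]%classic.
have cS : connected S by apply: segment_image_connected cphi _ => s /ta[].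
have SAB : S `<=` A `|` B.
  move=> q [s]; rewrite /= in_itv /= => /ta[Vs us] <-.
  suff : (A `|` B) (phi (t + s *: a)) by []; rewrite MAB.
  by split => //; exact: Mphi.
have S0 : S (phi t) by exists 0; rewrite ?scale0r ?addr0 //= in_itv /= lexx ler01.
have S1 : S (phi (t + a)) by exists 1; rewrite ?scale1r //= in_itv /= lexx ler01.
have dAB := separated_disjoint AB.
have [SA|SB] := connected_subset AB SAB cS; first by split => _; exact: SA.
by split => Aq; exfalso; have : (A `&` B) !=set0 by [exists (phi t); split=> //; exact: SB|
  exists (phi (t + a)); split => //; exact: SB]; rewrite dAB => -[].
Qed.

(** This is the bound [Z >= C] near a point of the equator, written without dividing by the heights.
    At a critical point of the height it is a quadratic estimate; at a regular point it holds
    because no pair in [A] and [B] lies close to [phi t0]. *)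
Lemma pieces_apart_near (C : R) : 0 <= C -> (forall q, M q -> dot q q = 1) ->
  dot (phi t0) nu = 0 ->
  exists O, [/\ open O, O (phi t0) & forall x y, A x -> B y -> O x -> O y ->
    C * (dot x nu * dot y nu) <= 1 - dot x y].
Proof.
have [[oV Vt0 sphi] [oW Wp sg] [Mphi _] gK [gp [L0 gL0]]] := chart.
move=> C0 M1 u0.
have MA q : A q -> M q /\ 0 < dot q nu.
  by move=> Aq; have : (A `|` B) q by [left]; rewrite MAB.
have MB q : B q -> M q /\ 0 < dot q nu.
  by move=> Bq; have : (A `|` B) q by [right]; rewrite MAB.
have dAB q : A q -> B q -> False.
  by move=> Aq Bq; have : (A `&` B) q by []; rewrite (separated_disjoint AB).
have cg q : W q -> {for q, continuous g} by move=> Wq; exact: (C_on_continuous (sg 0%N) Wq).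
(* Ambient neighbourhoods of [phi t0] on which the parameter [g q] is within [r] of [t0]. *)
have [Nb Nbopen] : exists Nb : R -> set 'rV[R]_n, forall r, 0 < r ->
    [/\ open (Nb r), Nb r (phi t0) &
    forall q, Nb r q -> W q /\ ball t0 r (g q)].
  exists (fun r => W `&` g @^-1` (ball t0 r)) => r r0.
  have oB : open (ball t0 r) by exact: ball_open.
  split => //; first exact: (@open_preimage_on R _ _ W (ball t0 r) g oW oB cg).
  by apply: (conj Wp); rewrite /= gp; exact: ballxx.
pose w t := dot (phi t) nu.
have sw r : C_on r V w.
  apply: C_on_sum => // i _; apply: C_onM => //; last exact: C_on_cst.
  by apply: C_on_coord => //; exact: sphi.
have dw t : V t -> differentiable w t by have [d _] := (C_onS _ _ _).1 (sw 1%N); exact: d.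
have Vnear : \forall t \near t0, V t by exact: open_nbhs_nbhs.
have [Dw0|] := pselect (forall v, 'D_v w t0 = 0).
  pose L := `|L0| + 1.
  have L1 : 1 <= L by rewrite lerDr.
  (* Chosen so that [eps * L = 1 / (2 * (C + 1))], whose square times [C] is at most [1 / 2]; the
     bound is closed by [|y - x|^2 <= 2 * (1 - dot x y)]. *)
  pose eps := (2 * (C + 1) * L)^-1.
  have L00 : 0 < L by lra.
  have eps0 : 0 < eps by rewrite invr_gt0 !mulr_gt0 //; lra.
  have wlip := small_derivative_lipschitz oV Vt0 (sw 1%N) Dw0 eps0.
  have [r [r0 wr rV]] : exists r : R, [/\ 0 < r, (forall x y, ball t0 r x -> ball t0 r y ->
      `|w y - w x| <= eps * `|y - x|) & ball t0 r `<=` V].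
    have [r [r0 [wr rV]]] := filter_ex (filterI (nbhs_right_gt 0)
      (filterI wlip (ball_near_right Vnear))).
    by exists r.
  have [oO Op OW] := Nbopen r r0.
  exists (Nb r); split => // x y Ax By Ox Oy.
  have [[Mx ux] [My uy]] := (MA x Ax, MB y By).
  have [[Wx gx] [Wy gy]] := (OW x Ox, OW y Oy).
  have [Vgx phix] := gK x Mx Wx; have [Vgy phiy] := gK y My Wy.
  set t := g x in gx phix; set t' := g y in gy phiy.
  (* If the whole segment of parameters stayed on the positive side, [y] would belong to [A]. At a
     parameter of height at most [0] on the segment, the small Lipschitz constant bounds the heights
     of both ends. *)
  have [s [s01 ws]] : exists s : R, 0 <= s <= 1 /\ w (t + s *: (t' - t)) <= 0.
    apply: contrapT => H.
    have : A (phi (t + (t' - t))).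
      apply: (proj1 (@segment_same_piece t (t' - t) _)); last by rewrite phix.
      move=> s s01; split; first by apply: rV; exact: ball_convex.
      by rewrite ltNge; apply/negP => ws; apply: H; exists s.
    by rewrite addrC subrK phiy => /dAB; exact.
  have zr := ball_convex gx gy s01.
  have /andP[s0 s1] := s01.
  have h1 := wr _ _ zr gx; have h2 := wr _ _ zr gy.
  have wt : w t = dot x nu by rewrite /w phix.
  have wt' : w t' = dot y nu by rewrite /w phiy.
  set z := t + s *: (t' - t) in ws zr h1 h2.
  have n1 : `|t - z| <= `|t' - t|.
    rewrite /z opprD addrA subrr add0r normrN normrZ ger0_norm //.
    by rewrite ler_piMl.
  have n2 : `|t' - z| <= `|t' - t|.
    rewrite (_ : t' - z = (1 - s) *: (t' - t)).
      by rewrite normrZ ger0_norm ?subr_ge0// ler_piMl// gerBl.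
    by rewrite /z opprD addrA scalerBl scale1r.
  have d0 : 0 <= `|t' - t| by [].
  have ux' : dot x nu <= eps * `|t' - t|.
    have : eps * `|t - z| <= eps * `|t' - t| by rewrite ler_wpM2l // ltW.
    have := ler_norm (w t - w z); rewrite wt in h1 *; lra.
  have uy' : dot y nu <= eps * `|t' - t|.
    have : eps * `|t' - z| <= eps * `|t' - t| by rewrite ler_wpM2l // ltW.
    have := ler_norm (w t' - w z); rewrite wt' in h2 *; lra.
  have tL : `|t' - t| <= L * `|y - x|.
    apply: (le_trans (gL0 y x My Wy Mx Wx)); rewrite ler_wpM2r // /L.
    by have := ler_norm L0; lra.
  have uv : dot x nu * dot y nu <= (eps * (L * `|y - x|)) ^+ 2.
    have H : eps * `|t' - t| <= eps * (L * `|y - x|) by rewrite ler_wpM2l // ltW.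
    by rewrite expr2; apply: ler_pM; [exact: ltW|exact: ltW|exact: le_trans H|exact: le_trans H].
  have eL : eps * L = (2 * (C + 1))^-1 by rewrite /eps invfM mulfVK // gt_eqF.
  have yx : `|y - x| ^+ 2 <= 2 - 2 * dot x y.
    apply: (le_trans (norm_sqr_le_dot _)).
    by rewrite !(dotBl, dotBr) (M1 _ Mx) (M1 _ My) (dotC y x); lra.
  have q0 : 0 <= `|y - x| ^+ 2 by rewrite sqr_ge0.
  have : C * (dot x nu * dot y nu) <= C * ((2 * (C + 1))^-1 ^+ 2 * `|y - x| ^+ 2).
    by rewrite ler_wpM2l // (le_trans uv) // mulrA eL exprMn.
  have : C * (2 * (C + 1))^-1 ^+ 2 <= 2^-1.
    rewrite exprVn ler_pdivrMr ?exprn_gt0 //; last lra.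
    by rewrite expr2; nra.
  move=> k1 k2; apply: (le_trans k2); rewrite mulrA.
  apply: (@le_trans _ _ (2^-1 * `|y - x| ^+ 2)); first by rewrite ler_wpM2r.
  lra.
(* Regular case: the parameters of two nearby points are joined on the positive side by rising along
   [a], moving across at the raised level and descending again, so both points lie in the same
   piece. *)
move=> /existsNP[v0 /eqP Dv0].
have [v Dv] : exists v, 0 < 'D_v w t0.
  have [D|D] := ltP 0 ('D_v0 w t0); first by exists v0.
  exists (- v0); rewrite deriveE ?linearN /= -?deriveE ?oppr_gt0; try exact: dw.
  by rewrite lt_def eq_sym in D *; rewrite Dv0.
have cD : {for t0, continuous ('D_v w)}.
  by have [_ D] := (C_onS _ _ _).1 (sw 1%N); exact: D.
have Dnear : \forall t \near t0, 0 < 'D_v w t by exact: (cvgr_gt _ cD).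
have [r r0 rP] : exists2 r, 0 < r & ball t0 r `<=` [set t | V t /\ 0 < 'D_v w t].
  have : \forall t \near t0, V t /\ 0 < 'D_v w t by apply: filterS2 Vnear Dnear.
  by move=> /nbhs_ballP[r /= r0 rP]; exists r.
pose sg0 := r / (4 * (`|v| + 1)).
have v1 : 0 < `|v| + 1 by rewrite ltr_wpDl.
have sg00 : 0 < sg0 by rewrite divr_gt0 // mulr_gt0.
pose a := sg0 *: v.
have na : `|a| <= r / 4.
  have sE : sg0 * (`|v| + 1) = r / 4 by rewrite /sg0; field; rewrite gt_eqF.
  by rewrite normrZ gtr0_norm // -sE ler_pM2l // lerDl.
have inball t (s : R) : ball t0 (r / 2) t -> 0 <= s <= 1 -> ball t0 r (t + s *: a).
  rewrite -!ball_normE /= opprD addrA => tr /andP[s0 s1].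
  apply: (le_lt_trans (ler_normB _ _)); rewrite normrZ ger0_norm //.
  have : s * `|a| <= `|a| by rewrite ler_piMl.
  lra.
have wincr t (s : R) : ball t0 (r / 2) t -> 0 < s <= 1 -> w t < w (t + s *: a).
  move=> tr /andP[s0 s1].
  have s0' := ltW s0.
  have db (h : R) : 0 <= h <= s -> is_derive h 1 (fun h => w (t + h *: a)) ('D_a w (t + h *: a)).
    move=> /andP[h0 hs]; apply: is_derive_line; apply: dw.
    by have [] := rP _ (inball t h tr ltac:(by rewrite h0 (le_trans hs s1))).
  have [| |x] := @MVT_segment R (fun h => w (t + h *: a)) (fun h => 'D_a w (t + h *: a)) 0 s s0'.
  - by move=> h; rewrite in_itv /= => /andP[h0 hs]; apply: db; rewrite !ltW.
  - by apply: derivable_within_continuous => h; rewrite in_itv /= => hs; have [] := db h hs.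
  rewrite in_itv /= => /andP[x0 xs]; rewrite scale0r addr0 subr0 => E.
  have x1 : x <= 1 by exact: le_trans xs s1.
  have [Vx Dx] := rP _ (inball t x tr ltac:(by rewrite x0 x1)).
  rewrite -subr_gt0 E mulr_gt0 // deriveE; last exact: dw.
  rewrite /a linearZ /= -(deriveE v (dw _ Vx)).
  by rewrite /GRing.scale /= mulr_gt0.
have r20 : 0 < r / 2 by rewrite divr_gt0.
have wa0 : 0 < w (t0 + a).
  have := wincr t0 1 (ballxx _ r20) ltac:(by rewrite ltr01 lexx).
  by rewrite scale1r {1}/w u0.
have Va : V (t0 + a).
  by have := inball t0 1 (ballxx _ r20) ltac:(by rewrite ler01 lexx); rewrite scale1r => /rP[].
(* The segment between the two parameters may itself reach negative heights; translated by [a] it is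
   on the positive side, by continuity from [w (t0 + a) > 0]. *)
have wanear : \forall t \near t0, 0 < w (t + a).
  have near' : \forall t \near t0 + a, 0 < w t.
    exact: (cvgr_gt _ (differentiable_continuous (dw _ Va))).
  have ca : {for t0, continuous (fun t => t + a)}.
    apply: (@near_lipschitz_continuous _ _ _ (fun t => t + a) t0 1).
    by apply: filterS Vnear => t _; rewrite opprD addrACA subrr addr0 mul1r.
  exact: ca near'.
have bnear : \forall t \near t0, ball t0 (r / 2) t by exact: nbhsx_ballx.
have [d d0 dP] : exists2 d, 0 < d & ball t0 d `<=` [set t | 0 < w (t + a) /\ ball t0 (r / 2) t].
  have : \forall t \near t0, 0 < w (t + a) /\ ball t0 (r / 2) t by apply: filterS2 wanear bnear.
  by move=> /nbhs_ballP[d /= d0 dP]; exists d.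
have [oO Op OW] := Nbopen d d0.
exists (Nb d); split => // x y Ax By Ox Oy; exfalso.
have [[Mx ux] [My uy]] := (MA x Ax, MB y By).
have [[Wx gx] [Wy gy]] := (OW x Ox, OW y Oy).
have [Vgx phix] := gK x Mx Wx; have [Vgy phiy] := gK y My Wy.
have up t : ball t0 d t -> 0 < w t -> A (phi t) <-> A (phi (t + a)).
  move=> td wt; apply: segment_same_piece => s /andP[s0 s1].
  have [_ tr] := dP t td.
  have [Vs _] := rP _ (inball t s tr ltac:(by rewrite s0 s1)).
  split => //; have [->|sn0] := eqVneq s 0; first by rewrite scale0r addr0.
  by apply: (lt_trans wt); apply: wincr => //; rewrite lt_def sn0 s0.
have wgx : 0 < w (g x) by rewrite /w phix.
have wgy : 0 < w (g y) by rewrite /w phiy.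
have A1 : A (phi (g x + a)) by apply: (proj1 (up _ gx wgx)); rewrite phix.
have A2 : A (phi ((g x + a) + (g y - g x))).
  apply: (proj1 (@segment_same_piece (g x + a) (g y - g x) _)); last exact: A1.
  move=> s s01; have [wz zr] := dP _ (ball_convex gx gy s01).
  rewrite -addrA [a + _]addrC addrA; split => //.
  by have [] := rP _ (inball _ 1 zr ltac:(by rewrite ler01 lexx)); rewrite scale1r.
apply: (dAB y) => //; rewrite -phiy; apply: (proj2 (up _ gy wgy)).
by move: A2; rewrite addrAC [g x + _]addrC subrK.
Qed.

End Pieces.

(** Uniform version, by compactness of [M]. The pairs that may violate the inequality avoid the
    neighbourhoods given by [pieces_apart_near] and lie in a compact set [L] on which the product of
    the heights is positive, hence bounded below. *)
Lemma pieces_apart (R : realType) (k : nat) (M A B : set 'rV[R]_k.+1) (nu : 'rV[R]_k.+1) (C : R) :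
  embedded_hypersurface M -> compact M -> sphere nu -> separated A B ->
  A `|` B = M `&` [set q | 0 < dot q nu] -> 0 <= C ->
  exists2 h : R, 0 < h & forall x y, A x -> B y -> dot x nu <= h \/ dot y nu <= h ->
    C * (dot x nu * dot y nu) <= 1 - dot x y.
Proof.
move=> [MS Msub] cM nn AB MAB C0.
have M1 q : M q -> dot q q = 1 by exact: MS.
have MA q : A q -> M q /\ 0 < dot q nu.
  by move=> Aq; have : (A `|` B) q by [left]; rewrite MAB.
have MB q : B q -> M q /\ 0 < dot q nu.
  by move=> Bq; have : (A `|` B) q by [right]; rewrite MAB.
pose T : topologicalType := ('rV[R]_k.+1 * 'rV[R]_k.+1)%type.
pose good (O : set 'rV[R]_k.+1) := open O /\ forall x y, A x -> B y -> O x -> O y ->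
    C * (dot x nu * dot y nu) <= 1 - dot x y.
pose G : set T := \bigcup_(O in good) (O `*` O).
have oG : open G.
  rewrite openE => z [Q [oQ HQ] [Qz1 Qz2]].
  exists (Q, Q); first by split; exact: open_nbhs_nbhs.
  by move=> p [p1 p2]; exists Q.
pose u (z : T) := dot z.1 nu; pose v (z : T) := dot z.2 nu.
pose d (z : T) := dot z.1 z.2.
have cu : continuous u by exact: continuous_dot_fst.
have cv : continuous v by exact: continuous_dot_snd.
have cd : continuous d by exact: continuous_dot.
have cuv : continuous (fun z => u z * v z) by move=> z; apply: cvgM; [exact: cu|exact: cv].
pose F z := d z + C * (u z * v z).
have cF : continuous F.
  by move=> z; apply: cvgD; [exact: cd|apply: cvgMr; exact: cuv].
(* [1 <= F z] is failure of the inequality, made weak so that [L] is closed. *)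
pose L := (M `*` M) `&` (~` G `&`
  ((u @^-1` [set x | 0 <= x] `&` v @^-1` [set x | 0 <= x]) `&` F @^-1` [set x | 1 <= x])).
have cL : compact L.
  apply: compact_closedI; first exact: compact_setX.
  apply: closedI; first exact: open_closedC.
  apply: closedI; last by apply: closed_comp; [move=> z _; exact: cF|exact: closed_ge].
  by apply: closedI; apply: closed_comp;
    [move=> z _; exact: cu|exact: closed_ge|move=> z _; exact: cv|exact: closed_ge].
(* A vanishing product in [L] would force [dot z.1 z.2 >= 1], so that the two points coincide and
   lie on the equator; such a diagonal pair belongs to [G]. *)
have Lpos z : L z -> 0 < u z * v z.
  move=> [[Mx My] [nG [[u0 v0] F1]]]; rewrite lt_def mulr_ge0 // andbT.
  apply/negP => /eqP uv0; apply: nG.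
  have xy : z.1 = z.2.
    by apply: dot_eq1; [exact: M1|exact: M1|move: F1; rewrite /= /F uv0 mulr0 addr0].
  have u00 : dot z.1 nu = 0.
    by move/eqP: uv0; rewrite mulf_eq0 /u /v -xy orbb => /eqP.
  have [t0 [V [phi [W [g [phit0 chart]]]]]] := smooth_chart_exists Msub Mx.
  rewrite -phit0 in u00.
  have [Q [oQ Qp QP]] := pieces_apart_near AB MAB chart C0 M1 u00.
  exists Q; first by [].
  by split; rewrite /= -?xy -phit0.
have small (h : R) x y : (forall z, L z -> h < u z * v z) -> A x -> B y ->
    dot x nu <= h \/ dot y nu <= h -> C * (dot x nu * dot y nu) <= 1 - dot x y.
  move=> hL Ax By xyh; have [[Mx ux] [My uy]] := (MA x Ax, MB y By).
  have [[Q [oQ QP] [Qx Qy]]|nG] := pselect (G (x, y)); first exact: QP.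
  rewrite leNgt; apply/negP => Fxy.
  have Lxy : L (x, y).
    split => //; split => //; split; first by split; exact: ltW.
    by rewrite /= /F /d /u /v /=; lra.
  have := hL _ Lxy; rewrite /u /v /=.
  (* Heights are at most [1], so the product is at most [h] as soon as one of them is. *)
  have ux1 := dot_le1 (M1 x Mx) nn; have uy1 := dot_le1 (M1 y My) nn.
  by case: xyh => hh; nra.
have [L0|/set0P L0] := eqVneq L set0.
  by exists 1 => // x y; apply: small => z; rewrite L0.
have [z0 /set_mem Lz0 z0min] := compact_EVT_min L0 cL (continuous_subspaceT cuv).
have uv0 := Lpos _ Lz0.
exists (u z0 * v z0 / 2); first by rewrite divr_gt0.
move=> x y; apply: small => z Lz; apply: (@lt_le_trans _ _ (u z0 * v z0)); first by lra.
by apply: z0min; exact/mem_set.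
Qed.

(** * An interior extremum of the two-point function, and the theorem *)

Lemma hemisphere_pos_connected (R : realType) (m : nat) (M : set 'rV[R]_m.+3) (nu : 'rV[R]_m.+3) :
  @embedded_hypersurface R m.+2 M -> compact M -> @minimal R m.+2 M -> @sphere R m.+2 nu ->
  connected (M `&` @open_hemisphere_pos R m.+2 nu).
Proof.
move=> Mhyp cM Mmin nn; have [MS _] := Mhyp.
have M1 q : M q -> dot q q = 1 by exact: MS.
apply: contrapT => /connectedPn[E [E0 MAB AB]].
have [x1 Ax1] := E0 false; have [y1 By1] := E0 true; move: MAB AB Ax1 By1.
set A := E false; set B := E true => MAB AB Ax1 By1.
have {}MAB : A `|` B = M `&` [set q | 0 < dot q nu].
  rewrite -MAB; apply/seteqP; split => q [Mq]; first by move=> [_ uq].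
  by move=> uq; split => //; split => //; exact: MS.
have MA q : A q -> M q /\ 0 < dot q nu.
  by move=> Aq; have : (A `|` B) q by [left]; rewrite MAB.
have MB q : B q -> M q /\ 0 < dot q nu.
  by move=> Bq; have : (A `|` B) q by [right]; rewrite MAB.
have AorB q : M q -> 0 < dot q nu -> A q \/ B q.
  by move=> Mq uq; have : (A `|` B) q by rewrite MAB.
have nclB q : A q -> ~ closure B q.
  by move=> Aq Bq; have : (A `&` closure B) q by []; rewrite AB.2.
have nclA q : B q -> ~ closure A q.
  by move=> Bq Aq; have : (closure A `&` B) q by []; rewrite AB.1.
have [Mx1 ux1] := MA _ Ax1; have [My1 uy1] := MB _ By1.
have lt1 x y : A x -> B y -> dot x y < 1.
  move=> Ax By.
  have xx : dot x x = 1 by apply: M1; exact: (MA x Ax).1.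
  have yy : dot y y = 1 by apply: M1; exact: (MB y By).1.
  rewrite ltNge; apply/negP => /(dot_eq1 xx yy) xy.
  by apply: (nclB x Ax); rewrite xy; exact: subset_closure.
pose Z x y := (1 - dot x y) / (dot x nu * dot y nu).
have Z10 : 0 < Z x1 y1 by rewrite divr_gt0 ?subr_gt0 ?lt1 // mulr_gt0.
(* The margin [1] above a value attained by [Z] is used twice: pairs with [Z < C] have both heights
   above [h], and the minimum [c0] is at most [C - 1]. *)
pose C := Z x1 y1 + 1.
have C0 : 0 <= C by rewrite addr_ge0 // ltW.
have [h h0 hC] := pieces_apart Mhyp cM nn AB MAB C0.
pose T : topologicalType := ('rV[R]_m.+3 * 'rV[R]_m.+3)%type.
have cdot : continuous (fun z : T => dot z.1 z.2) by exact: continuous_dot.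
have cu : continuous (fun z : T => dot z.1 nu) by exact: continuous_dot_fst.
have cv : continuous (fun z : T => dot z.2 nu) by exact: continuous_dot_snd.
(* A piece need not be closed in [M], but its part of height at least [h] is: a limit point still
   has positive height, so it is in [D] or [D'], and separation excludes [D']. *)
have cslice (D D' : set 'rV[R]_m.+3) : (forall q, D q -> M q /\ 0 < dot q nu) ->
    (forall q, D' q -> ~ closure D q) -> (forall q, M q -> 0 < dot q nu -> D q \/ D' q) ->
    compact (D `&` [set q | h <= dot q nu]).
  move=> MD nclD DorD'.
  have -> : D `&` [set q | h <= dot q nu] = M `&` (closure D `&` [set q | h <= dot q nu]).
    apply/seteqP; split => q /=.
      by move=> [Dq hq]; split; [exact: (MD q Dq).1|split=> //; exact: subset_closure].
    move=> [Mq [Dq hq]]; split => //.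
    by have [//|/nclD] := DorD' q Mq (lt_le_trans h0 hq).
  apply: compact_closedI => //; apply: closedI; first exact: closed_closure.
  have := @closed_comp _ _ (fun q : 'rV[R]_m.+3 => dot q nu) [set x | h <= x].
  by apply; [move=> q _; exact: continuous_dotl|exact: closed_ge].
pose K : set T := (A `&` [set q | h <= dot q nu]) `*` (B `&` [set q | h <= dot q nu]).
have cK : compact K.
  apply: compact_setX; first exact: cslice nclA AorB.
  by apply: cslice nclB _ => // q Mq uq; apply/or_comm; exact: AorB.
have ZC x y : A x -> B y -> Z x y < C -> h < dot x nu /\ h < dot y nu.
  move=> Ax By; have [[_ ux] [_ uy]] := (MA x Ax, MB y By).
  rewrite /Z ltr_pdivrMr ?mulr_gt0 // => zc.
  split; rewrite ltNge; apply/negP => hh.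
    by have := hC x y Ax By (or_introl hh); lra.
  by have := hC x y Ax By (or_intror hh); lra.
have K1 : K (x1, y1).
  have [hx hy] : h < dot x1 nu /\ h < dot y1 nu by apply: ZC => //; rewrite /C ltrDl.
  by split; split => //=; exact: ltW.
have Kuv z : K z -> 0 < dot z.1 nu * dot z.2 nu.
  by move=> [[/MA[_ ?] _] [/MB[_ ?] _]]; rewrite mulr_gt0.
have [[x0 y0] /set_mem [/= [Ax0 hx0] [By0 hy0]] Zmin] :
    exists2 z, z \in K & forall t, t \in K -> Z z.1 z.2 <= Z t.1 t.2.
  apply: (@compact_EVT_min T R (fun z => Z z.1 z.2)) => //; first by exists (x1, y1).
  apply: continuous_in_subspaceT => z /set_mem Kz.
  apply: cvgM; first by apply: cvgB; [exact: cvg_cst|exact: cdot].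
  by apply: cvgV; [rewrite gt_eqF // Kuv|apply: cvgM; [exact: cu|exact: cv]].
have [[Mx0 ux0] [My0 uy0]] := (MA x0 Ax0, MB y0 By0).
pose c0 := Z x0 y0.
have c00 : 0 < c0 by rewrite divr_gt0 ?subr_gt0 ?lt1 // mulr_gt0.
have c0C : c0 + 1 <= C by rewrite lerD2r; apply: (Zmin (x1, y1)); exact/mem_set.
have ZE x y : A x -> B y -> 1 - dot x y = Z x y * (dot x nu * dot y nu).
  move=> /MA[_ ux] /MB[_ uy]; rewrite /Z mulrVK // unitfE gt_eqF // mulr_gt0 //.
(* The three bounds give in turn [c > 0], [s > 0] and a minimum of [H] off the boundary of [K]; the
   half makes them strict. *)
pose eta := Num.min c0 (Num.min 1 (h ^+ 2)) / 2.
have m0 : 0 < Num.min c0 (Num.min 1 (h ^+ 2)) by rewrite !lt_min c00 ltr01 exprn_gt0.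
have e0 : 0 < eta by rewrite divr_gt0.
have ec0 : eta < c0.
  have : Num.min c0 (Num.min 1 (h ^+ 2)) <= c0 by rewrite ge_min lexx.
  by rewrite /eta in e0 *; lra.
have e1 : eta < 1.
  have : Num.min c0 (Num.min 1 (h ^+ 2)) <= 1 by rewrite !ge_min lexx orbT.
  by rewrite /eta in e0 *; lra.
have eh : eta < h ^+ 2.
  have : Num.min c0 (Num.min 1 (h ^+ 2)) <= h ^+ 2 by rewrite !ge_min lexx !orbT.
  by rewrite /eta in e0 *; lra.
pose c := c0 - eta.
have c_gt0 : 0 < c by rewrite subr_gt0.
(* By [ZE], [H] equals [Z - c] times the product of the heights, and [1 - H] is the bilinear form of
   [P]. Taking [c] below [c0] makes the minimum of [H] positive, which yields [s < 1]. *)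
pose H x y := 1 - dot x y - c * (dot x nu * dot y nu).
have [[x y] /set_mem [/= [Ax hx] [By hy]] Hmin] :
    exists2 z, z \in K & forall t, t \in K -> H z.1 z.2 <= H t.1 t.2.
  apply: (@compact_EVT_min T R (fun z => H z.1 z.2)) => //; first by exists (x1, y1).
  apply: continuous_subspaceT => z.
  apply: cvgB; first by apply: cvgB; [exact: cvg_cst|exact: cdot].
  by apply: cvgMr; apply: cvgM; [exact: cu|exact: cv].
have [[Mx ux] [My uy]] := (MA x Ax, MB y By).
have uv : 0 < dot x nu * dot y nu by rewrite mulr_gt0.
have Hxy0 : 0 < H x y.
  have : c0 <= Z x y by apply: (Zmin (x, y)); exact/mem_set.
  by rewrite /H (ZE x y) // -mulrBl => ?; rewrite mulr_gt0 // /c; lra.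
have Hxy : H x y <= eta.
  have : H x y <= H x0 y0 by apply: (Hmin (x0, y0)); exact/mem_set.
  rewrite {2}/H (ZE x0 y0) // -mulrBl -/c0 (_ : c0 - c = eta); last by rewrite /c; ring.
  have ux1' := dot_le1 (M1 _ Mx0) nn; have uy1' := dot_le1 (M1 _ My0) nn.
  have : eta * (dot x0 nu * dot y0 nu) <= eta * 1 
    by apply: ler_wpM2l; [exact: ltW|apply: mulr_ile1 => //; exact: ltW].
  by rewrite mulr1; lra.
(* If [Z x y >= C], then [H x y] is at least [(C - c) * h ^+ 2 >= h ^+ 2 > eta], against the bound
   just proved; hence [ZC] applies. *)
have [hx' hy'] : h < dot x nu /\ h < dot y nu.
  apply: ZC => //; apply: contrapT => /negP; rewrite -leNgt => CZ.
  have : h ^+ 2 <= dot x nu * dot y nu by rewrite expr2 ler_pM // ltW.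
  have : (C - c) * (dot x nu * dot y nu) <= H x y.
    rewrite /H (ZE x y) // -mulrBl.
    by apply: ler_wpM2r; [exact: ltW|rewrite lerD2r].
  have : 1 <= C - c by rewrite /c; lra.
  by nra.
pose s := 1 - H x y.
have oU : open [set q : 'rV[R]_m.+3 | h < dot q nu].
  have := @open_comp _ _ (fun q : 'rV[R]_m.+3 => dot q nu) [set x | h < x].
  by apply; [move=> q _; exact: continuous_dotl|exact: open_gt].
have oD (D : set 'rV[R]_m.+3) : open (~` closure D `&` [set q | h < dot q nu]).
  by apply: openI => //; apply: closed_openC; exact: closed_closure.
have PE a b : dot a (b *m (1%:M + c *: (nu^T *m nu))) = 1 - H a b.
  rewrite mulmxDr mulmx1 -scalemxAr mulmxA mul_rV_tr mul_scalar_mx scalerA dotDr dotZr /H.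
  ring.
(* These open sets single out the pieces: a point of [M] of height above [h] outside the closure of
   [B] is in [A], and symmetrically. Nearby pairs in [M] therefore stay in [K], where [H] is
   minimal. *)
apply: (@no_interior_maximum R m M (~` closure B `&` [set q | h < dot q nu])
  (~` closure A `&` [set q | h < dot q nu]) x y nu c s) => //.
- by split => //; exact: nclB.
- by split => //; exact: nclA.
- by rewrite /s subr_gt0 (le_lt_trans Hxy e1) gtrBl.
move=> x' y' Mx' [nBx' hx''] My' [nAy' hy'']; rewrite PE /s lerD2l lerN2.
have Ax' : A x'.
  by have [//|Bx'] := AorB x' Mx' (lt_trans h0 hx''); exfalso; apply: nBx'; exact: subset_closure.
have By' : B y'.
  by have [Ay'|//] := AorB y' My' (lt_trans h0 hy''); exfalso; apply: nAy'; exact: subset_closure.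
by apply: (Hmin (x', y')); apply/mem_set; split; split => //=; exact: ltW.
Qed.

Lemma open_hemisphere_negE (R : realType) (k : nat) (nu : 'rV[R]_k.+1) :
  open_hemisphere_neg nu = open_hemisphere_pos (- nu).
Proof. apply/seteqP; split => q [qS uq]; split=> //; move: uq; by rewrite dotNr oppr_gt0. Qed.

Theorem theorem3 (R : realType) (k : nat) (hk : (2 <= k)%N)
    (M : set 'rV[R]_k.+1)
    (M_hyp : embedded_hypersurface M)
    (M_compact : compact M)
    (M_connected : connected M)
    (M_minimal : minimal M) :
  forall nu : 'rV[R]_k.+1, sphere nu ->
    [/\ connected (M `&` open_hemisphere_pos nu),
        connected (M `&` open_hemisphere_neg nu) &
        M `\` equator nu =
          (M `&` open_hemisphere_pos nu) `|` (M `&` open_hemisphere_neg nu)].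
Proof.
move=> nu nuS; have [MS _] := M_hyp.
(* Writing [k = m + 2] turns the dimension [k - 1] into the successor [m.+1], the form in which the
   frames are indexed. *)
case: k hk M nu M_hyp M_compact M_connected M_minimal nuS MS => [|[|m]] // _.
move=> M nu Mhyp cM _ Mmin nuS MS.
split.
- exact: hemisphere_pos_connected.
- rewrite open_hemisphere_negE; apply: hemisphere_pos_connected => //.
  by rewrite /sphere /= dotNl dotNr opprK.
- rewrite -setIUr; apply/seteqP; split => q [Mq] /= => [nE|H]; split=> //.
    have [uq|uq|uq] := ltgtP (dot q nu) 0.
    + by right; split => //; exact: MS.
    + by left; split => //; exact: MS.
    + by exfalso; apply: nE; split => //; exact: MS.
  by move=> [_ q0]; case: H => -[_]; rewrite q0 ltxx.
Qed.
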